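(* Let $n,k$ be integers with $0\le k\le n-2$, and let $G$ be a simple connected graph of order $n$ with exactly $k$ cut vertices. Then $$RDD(G)\le RDD(G_{n,k}),$$ with equality if and only if $G\cong G_{n,k}$.
   Context: All graphs are finite and simple. $d_G(u)$ denotes the degree of $u$ and $d_G(u,v)$ the distance between $u$ and $v$ in $G$. The reciprocal degree distance of a connected graph $G$ is $RDD(G)=\sum_{\{u,v\}\subseteq V(G)}\frac{d_G(u)+d_G(v)}{d_G(u,v)}$, the sum being over all unordered pairs of distinct vertices. A cut vertex of a graph is a vertex whose removal increases the number of components. For $0\le k\le n-2$, $G_{n,k}$ is the graph of order $n$ obtained from the complete graph $K_{n-k}$ by adding $n-k$ paths of almost equal lengths, one at each vertex of $K_{n-k}$: each vertex of $K_{n-k}$ is identified with an end vertex of its own path (a path may be trivial, i.e. a single vertex), the paths are otherwise pairwise disjoint and disjoint from $K_{n-k}$, any two of these paths have lengths differing by at most $1$, and the total number of vertices is $n$. In particular $G_{n,0}=K_n$ and $G_{n,n-2}$ is the path on $n$ vertices. *)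

(* Defs.v *)
From mathcomp Require Import all_boot all_order all_algebra.

Set Implicit Arguments.
Unset Strict Implicit.
Unset Printing Implicit Defensive.

Import Order.TTheory GRing.Theory Num.Theory.

Record sgraph := SGraph {
  vertex :> finType;
  edge : rel vertex;
  edge_sym : symmetric edge;
  edge_irr : irreflexive edge }.

Arguments edge {s}.

Definition isomorphic (G H : sgraph) : Prop :=
  exists2 f : G -> H, bijective f & forall x y, edge (f x) (f y) = edge x y.

Definition degree (G : sgraph) (x : G) : nat := #|[set y | edge x y]|.

Definition walk_of_length (G : sgraph) (x y : G) (d : nat) : bool :=
  [exists p : d.-tuple G, path edge x p && (last x p == y)].

(* The least length of a walk from x to y; the search stops at #|G|, which is
   the (unused) value obtained when y is not reachable from x. *)
Definition distance (G : sgraph) (x y : G) : nat :=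
  find (walk_of_length x y) (iota 0 #|G|).

Definition connected (G : sgraph) : Prop := forall x y : G, connect edge x y.

Definition num_components (T : finType) (e : rel T) : nat := n_comp e predT.

Definition del_vertex (G : sgraph) (v : G) : rel {x : G | x != v} :=
  relpre val edge.

Definition cut_vertex (G : sgraph) (v : G) : bool :=
  num_components (@edge G) < num_components (@del_vertex G v).

(* Each unordered pair {x, y} of distinct vertices is represented once, by its
   ordering along the enumeration of the vertices. *)
Definition RDD (G : sgraph) : rat :=
  (\sum_(x : G) \sum_(y : G | (enum_rank x < enum_rank y)%N)
     (degree x + degree y)%:R / (distance x y)%:R)%R.

(* The complete graph K_m with, for each i < m, a path with l i edges attached
   at its i-th vertex.  The vertex (i, j) is the j-th one on the i-th path, and
   the vertices (i, 0) are those of K_m. *)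
Definition clique_paths_vertex (m : nat) (l : 'I_m -> nat) : finType :=
  {i : 'I_m & 'I_(l i).+1}.

Definition clique_paths_edge (m : nat) (l : 'I_m -> nat) :
    rel (clique_paths_vertex l) :=
  fun u v =>
    if tag u == tag v
    then ((tagged u).+1 == tagged v :> nat) || ((tagged v).+1 == tagged u :> nat)
    else (tagged u == 0 :> nat) && (tagged v == 0 :> nat).

Lemma clique_paths_sym m (l : 'I_m -> nat) : symmetric (@clique_paths_edge m l).
Proof.
by move=> u v; rewrite /clique_paths_edge eq_sym orbC [in RHS]andbC.
Qed.

Lemma clique_paths_irr m (l : 'I_m -> nat) : irreflexive (@clique_paths_edge m l).
Proof. by move=> u; rewrite /clique_paths_edge eqxx orbb gtn_eqF. Qed.

Definition clique_paths (m : nat) (l : 'I_m -> nat) : sgraph :=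
  SGraph (@clique_paths_sym m l) (@clique_paths_irr m l).

(* The k vertices outside K_(n-k) are shared out as evenly as possible among
   the n - k paths. *)
Definition balanced_length (n k : nat) (i : 'I_(n - k)) : nat :=
  k %/ (n - k) + (i < k %% (n - k)).

Definition Gnk (n k : nat) : sgraph := clique_paths (@balanced_length n k).

Lemma balanced_length_almost_equal n k (i j : 'I_(n - k)) :
  balanced_length i <= (balanced_length j).+1.
Proof.
rewrite /balanced_length -addnS leq_add2l.
by case: (_ < _); case: (_ < _).
Qed.

Lemma card_Gnk n k : k < n -> #|Gnk n k| = n.
Proof.
move=> ltkn; rewrite /Gnk /= card_tagged sumnE big_map big_enum /=.
under eq_bigr => i _ do rewrite card_ord /balanced_length -addSn.
rewrite big_split /= sum_nat_const card_ord.
have m_gt0 : 0 < n - k by rewrite subn_gt0.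
have -> : \sum_(i < n - k) (i < k %% (n - k)) = k %% (n - k).
  rewrite -[RHS]card_ord -sum1_card (big_ord_widen (n - k) (fun=> 1)).
    by rewrite [RHS]big_mkcond; apply: eq_bigr => i _; case: (_ < _).
  by rewrite ltnW // ltn_mod.
by rewrite mulnS -addnA mulnC -divn_eq subnK // ltnW.
Qed.

Lemma walk_of_length_path (G : sgraph) (x : G) p :
  path edge x p -> walk_of_length x (last x p) (size p).
Proof. by move=> xp; apply/existsP; exists (in_tuple p); rewrite xp /=. Qed.

Lemma distance_le (G : sgraph) (x : G) p :
  path edge x p -> distance x (last x p) <= size p.
Proof.
move=> xp; case: (ltnP (size p) #|G|) => [ltp | lep]; last first.
  by apply: leq_trans lep; rewrite -[#|G|](size_iota 0) find_size.
rewrite leqNgt; apply/negP => /(before_find 0).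
by rewrite nth_iota // walk_of_length_path.
Qed.

Lemma distance_attained (G : sgraph) (x y : G) :
  connect edge x y -> walk_of_length x y (distance x y).
Proof.
case/connectP=> p0 xp0 ->; case/shortenP: xp0 => p xp xp_uniq _.
have ltp : size p < #|G|.
  by rewrite -[(size p).+1]/(size (x :: p)) -(card_uniqP xp_uniq) max_card.
have hasw : has (walk_of_length x (last x p)) (iota 0 #|G|).
  by apply/hasP; exists (size p); rewrite ?mem_iota ?walk_of_length_path.
have := nth_find 0 hasw.
by rewrite nth_iota // -[X in _ < X](size_iota 0) -has_find.
Qed.

(* Main.v *)
(* Idea.  Adding an edge that destroys no cut vertex strictly increases RDD, so
   one may assume that G is saturated: two nonadjacent vertices are always
   separated by a cut vertex c, and G - c has exactly two components.  Such a
   graph behaves like a tree: from a fixed vertex w, geodesics pass each layer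
   at a unique point, adjacent vertices of one layer have a common parent, and
   below every vertex lies a vertex that is not a cut vertex.  Hence, if w is
   not a cut vertex and m = n - k is the number of vertices that are not cut
   vertices, every layer around w has at most m - 1 elements.

   Let m > 2.  Following the layers from w as long as they are singletons gives
   a pendant path attached to a clique Q; the rest of G is an isometric subgraph
   with m - 1 vertices that are not cut vertices, to which induction on n
   applies.  The difference between RDD G and RDD of the rest depends only on
   the sizes of the layers and on the number of edges inside layers.  It is
   largest when all layers have size m - 1 until the vertices are exhausted, that
   is, when the same path is attached to all the clique vertices of the balanced
   graph with m - 1 paths.  Moving a vertex from a longer to a shorter path
   increases RDD, so the result is at most RDD (Gnk n k).  If equality holds,
   then #|Q| = m - 1, which forces G to be K_m with attached paths, and the paths
   have to be balanced.  For m = 2 the saturated graph is a path. *)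
Require Import Defs.
From mathcomp Require Import all_boot all_order all_algebra all_fingroup.
From mathcomp Require Import zify ring lra.

Set Implicit Arguments.
Unset Strict Implicit.
Unset Printing Implicit Defensive.

Import Order.TTheory GRing.Theory Num.Theory.

(** * Distances and cut vertices *)

Section Metric.
Variable G : sgraph.
Hypothesis cG : connected G.
Implicit Types x y z c : G.

Lemma distance_xx x : distance x x = 0.
Proof. by apply/eqP; rewrite -leqn0; have := @distance_le G x [::] isT. Qed.

Lemma geodesic x y :
  exists p, [/\ path edge x p, last x p = y & size p = distance x y].
Proof.
have /existsP[p /andP[xp /eqP lp]] := distance_attained (cG x y).
by exists p; rewrite size_tuple.
Qed.

Lemma distance_eq0 x y : (distance x y == 0) = (x == y).
Proof.
apply/eqP/eqP => [d0|->]; last exact: distance_xx.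
have [p [_ lp sp]] := geodesic x y.
by rewrite d0 in sp; rewrite -lp (size0nil sp).
Qed.

Lemma distance_triangle x y z : distance x z <= distance x y + distance y z.
Proof.
have [p [xp lp <-]] := geodesic x y; have [q [yq lq <-]] := geodesic y z.
rewrite -size_cat -lq -lp -last_cat; apply: distance_le.
by rewrite cat_path xp lp.
Qed.

Lemma distance_edge_le x y : edge x y -> distance x y <= 1.
Proof. by move=> e; apply: (@distance_le G x [:: y]); rewrite /= e. Qed.

Lemma edge_neq x y : edge x y -> x != y.
Proof. by apply: contraTneq => ->; rewrite edge_irr. Qed.

Lemma distance_edge x y : edge x y -> distance x y = 1.
Proof.
move=> e; apply/eqP; rewrite eqn_leq distance_edge_le // lt0n distance_eq0.
exact: edge_neq.
Qed.

Lemma distance_sym x y : distance x y = distance y x.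
Proof.
suff le (u v : G) : distance u v <= distance v u by apply/eqP; rewrite eqn_leq !le.
have [p [up lp <-]] := geodesic v u.
have up' : path edge u (rev (belast v p)).
  by rewrite -lp rev_path (eq_path (e' := edge)) // => a b; rewrite /= edge_sym.
have := distance_le up'; rewrite size_rev size_belast.
suff -> : last u (rev (belast v p)) = v by [].
by case: p lp {up up'} => [|z p] //= _; rewrite rev_cons last_rcons.
Qed.

Lemma distance1_edge x y : distance x y = 1 -> edge x y.
Proof.
have [p [xp <- <-]] := geodesic x y.
by case: p xp => [|z [|]] //= /andP[].
Qed.

Lemma distance_pred x y i : distance x y = i.+1 ->
  exists2 z, edge z y & distance x z = i.
Proof.
have [p [xp lp sp]] := geodesic x y; rewrite -sp.
case/lastP: p xp lp sp => [|p z]//; rewrite rcons_path last_rcons size_rcons.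
move=> /andP[xp e] ze sp [<-]; subst z; exists (last x p) => //.
apply/eqP; rewrite eqn_leq distance_le //=.
have := distance_triangle x (last x p) y; rewrite -sp (distance_edge e).
by rewrite addn1 ltnS.
Qed.

Lemma distance_point x y i : i <= distance x y ->
  exists2 z, distance x z = i & distance x y = i + distance z y.
Proof.
move: {2}(distance x y) (erefl (distance x y)) => n.
elim: n y => [|n IH] y dn lei.
  by exists y; rewrite ?distance_xx; lia.
move: lei; rewrite leq_eqVlt => /predU1P[->|lti].
  by exists y; rewrite ?distance_xx ?addn0.
have [z e dz] := distance_pred dn.
have [|t dt dtz] := IH z dz; first by rewrite dz -ltnS -dn.
exists t => //; apply/eqP; rewrite eqn_leq.
have := distance_triangle x t y; rewrite dt => -> /=.
have := distance_triangle t z y; rewrite (distance_edge e); lia.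
Qed.

Lemma distance_edge_leS x y z : edge y z -> distance x z <= (distance x y).+1.
Proof.
by move=> e; have := distance_triangle x y z; rewrite (distance_edge e) addn1.
Qed.

End Metric.

(** Descending along the third hypothesis gives a walk of length [f y], and along any walk from [x]
    the value of [f] grows by at most one per step. Reachability comes out together with the
    distance. *)
Lemma distance_charact (G : sgraph) (x : G) (f : G -> nat) :
    f x = 0 -> (forall y z, edge y z -> f z <= (f y).+1) ->
    (forall y, y != x -> exists2 z, edge z y & f y = (f z).+1) ->
  forall y, connect edge x y /\ distance x y = f y.
Proof.
move=> f0 fle fpred y.
have [p [xp lp sp]] : exists p, [/\ path edge x p, last x p = y & size p = f y].
  move: {2}(f y) (erefl (f y)) => n; elim: n y => [|n IH] y fy.
    have [->|/fpred[z _]] := eqVneq y x; first by exists [::].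
    by rewrite fy.
  have [yx|/fpred[z e]] := eqVneq y x; first by rewrite yx f0 in fy.
  rewrite fy => -[/esym/[dup] fz /IH[p [xp lp sp]]].
  exists (rcons p y); rewrite rcons_path xp lp last_rcons size_rcons sp e.
  by rewrite fz.
have cxy : connect edge x y by apply/connectP; exists p.
split=> //; apply/eqP; rewrite eqn_leq -{1}lp -sp distance_le //=.
have /existsP[q /andP[xq /eqP lq]] := distance_attained cxy.
have {q xq lq} [q [xq lq <-]] : exists q, [/\ path edge x q, last x q = y &
    size q = distance x y] by exists q; rewrite size_tuple.
rewrite sp -lq; elim/last_ind: q xq {lq} => [|r z IH]; first by rewrite /= f0.
rewrite rcons_path last_rcons size_rcons => /andP[/IH le /fle] h.
by apply: leq_trans h _.
Qed.

(** A geodesic is mapped to a walk that is no longer, since each edge is kept or collapsed. This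
    serves inclusions, isomorphisms, added edges and the collapse of a pendant path. *)
Lemma distance_retract (G H : sgraph) (f : G -> H) : connected G ->
    (forall x y, edge x y -> f x = f y \/ edge (f x) (f y)) ->
  forall x y, connect edge (f x) (f y) /\ distance (f x) (f y) <= distance x y.
Proof.
move=> cG hf x y; have [p [xp <- <-]] := geodesic cG x y.
have [q [xq lq sq]] : exists q, [/\ path edge (f x) q,
    last (f x) q = f (last x p) & size q <= size p].
  elim/last_ind: p xp => [|p z IH]; first by exists [::].
  rewrite rcons_path last_rcons size_rcons.
  move=> /andP[/IH[q [xq lq sq]] /hf[<-|e]].
    by exists q; split=> //; apply: leqW.
  by exists (rcons q (f z)); rewrite rcons_path last_rcons size_rcons xq lq.
split; first by apply/connectP; exists q.
by apply: leq_trans sq; rewrite -lq distance_le.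
Qed.

Definition induced (G : sgraph) (A : {set G}) : sgraph :=
  @SGraph {x : G | x \in A} (relpre val edge)
    (fun x y => edge_sym (val x) (val y)) (fun x => edge_irr (val x)).

Lemma num_components_gt1 (T : finType) (e : rel T) : connect_sym e ->
  reflect (exists x y, ~~ connect e x y) (1 < num_components e).
Proof.
move=> se; rewrite /num_components /n_comp_mem.
apply: (iffP idP) => [/card_gt1P[x [y [/andP[rx _] /andP[ry _] xy]]]|[x [y nxy]]].
  exists x, y; apply: contra xy => /(fingraph.rootP se).
  by move/eqP: rx => ->; move/eqP: ry => ->; move=> ->.
apply/card_gt1P; exists (fingraph.root e x), (fingraph.root e y).
rewrite !inE !roots_root //; split=> //.
by apply: contra nxy => /eqP/(fingraph.rootP se).
Qed.

Section Cut.
Variable G : sgraph.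
Implicit Types x y z c : G.

(** Connectivity in G - c is expressed on the vertices of G itself, with [c] isolated, rather than
    on the subtype of [del_vertex]; [del_vertex_conn] relates the two. *)
Definition avoid c : rel G := [rel x y | [&& edge x y, x != c & y != c]].
Definition conn c : rel G := connect (avoid c).

Lemma avoid_sym c : symmetric (avoid c).
Proof. by move=> x y; rewrite /avoid /= edge_sym [(x != c) && _]andbC. Qed.

Lemma conn_sym c x y : conn c x y = conn c y x.
Proof. exact: sym_connect_sym (avoid_sym c) x y. Qed.

Lemma conn_trans c : transitive (conn c).
Proof. exact: connect_trans. Qed.

Lemma conn_edge c x y : edge x y -> x != c -> y != c -> conn c x y.
Proof. by move=> e xc yc; apply: connect1; rewrite /avoid /= e xc yc. Qed.

Lemma del_vertex_conn c (x y : {x : G | x != c}) :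
  connect (@del_vertex G c) x y = conn c (val x) (val y).
Proof.
apply/idP/idP => /connectP[p].
  elim: p x => [|z p IH] x /= => [_ ->|/andP[e zp] ly]; first exact: connect0.
  apply: conn_trans (IH z zp ly); apply: conn_edge; rewrite ?(valP x) ?(valP z) //.
elim: p x => [|z p IH] x /= => [_ /val_inj ->|/andP[/and3P[e _ zc] zp] ly].
  exact: connect0.
by apply: connect_trans (IH (Sub z zc) zp ly); apply: connect1.
Qed.

Lemma cut_vertexP c : connected G ->
  reflect (exists x y, [/\ x != c, y != c & ~~ conn c x y]) (cut_vertex c).
Proof.
move=> cG; rewrite /cut_vertex.
have -> : num_components (@edge G) = 1.
  have sG := @sym_connect_sym G edge (@edge_sym G).
  apply/eqP; rewrite eqn_leq leqNgt; apply/andP; split.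
    by apply/negP => /(num_components_gt1 sG)[x [y]]; rewrite cG.
  rewrite /num_components /n_comp_mem.
  by apply/card_gt0P; exists (fingraph.root edge c); rewrite !inE roots_root.
have sd : connect_sym (@del_vertex G c).
  by apply: sym_connect_sym => x y; rewrite /del_vertex /= edge_sym.
apply: (iffP (num_components_gt1 sd)) => [[x [y]]|[x [y [xc yc nxy]]]].
  by rewrite del_vertex_conn => h; exists (val x), (val y); rewrite (valP x) (valP y).
by exists (Sub x xc), (Sub y yc); rewrite del_vertex_conn.
Qed.

Lemma noncut_conn c x y : connected G -> ~~ cut_vertex c ->
  x != c -> y != c -> conn c x y.
Proof.
move=> cG /(cut_vertexP _ cG) h xc yc; apply/negPn/negP => nxy.
by case: h; exists x, y.
Qed.

Hypothesis cG : connected G.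

Definition between c x y := distance x y == distance x c + distance c y.

(** A geodesic from [x] to [y] misses [c]: if [c] were between [x] and the predecessor of [y], the
    last edge would also put it between [x] and [y]. *)
Lemma conn_not_between c x y : x != c -> y != c -> ~~ between c x y -> conn c x y.
Proof.
move: {2}(distance x y) (erefl (distance x y)) => n + xc.
elim: n y => [|n IH] y dn yc nb.
  by move/eqP: dn; rewrite distance_eq0 // => /eqP ->; apply: connect0.
have [z e dz] := distance_pred cG dn.
have zc : z != c.
  by apply: contra nb => /eqP <-; rewrite /between dn dz (distance_edge cG e) addn1.
apply: conn_trans (conn_edge e zc yc); apply: IH => //.
apply: contra nb => /eqP bz; rewrite /between eqn_leq distance_triangle //=.
have := distance_triangle cG c z y; rewrite (distance_edge cG e); lia.
Qed.

End Cut.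

(** * Saturated graphs *)

Section Saturated.
Variable G : sgraph.
Implicit Types x y z c u v p : G.

(* A graph to which no edge can be added without destroying a cut vertex.  The
   last clause says that G - c has no third component. *)
Definition saturated : bool :=
  [forall x : G, forall y : G, (x != y) ==> ~~ edge x y ==>
     [exists c, [&& c != x, c != y, ~~ conn c x y &
        [forall z, (z != c) ==> (conn c z x || conn c z y)]]]].

Lemma saturatedP : reflect
  (forall x y, x != y -> ~~ edge x y -> exists c, [/\ c != x, c != y,
     ~~ conn c x y & forall z, z != c -> conn c z x || conn c z y]) saturated.
Proof.
apply: (iffP forallP) => [h x y xy nxy|h x].
  move/forallP/(_ y): (h x); rewrite xy nxy /=.
  case/existsP=> c /and4P[cx cy ncxy /forallP hz]; exists c; split=> // z.
  by apply/implyP.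
apply/forallP=> y; apply/implyP=> xy; apply/implyP=> nxy.
have [c [cx cy ncxy hz]] := h x y xy nxy.
apply/existsP; exists c; rewrite cx cy ncxy /=.
by apply/forallP=> z; apply/implyP; apply: hz.
Qed.

(** The negation is phrased as what keeps every cut vertex when the edge is added: [x] and [y] are
    already connected in G - c, or G - c has a component containing neither. *)
Lemma nsaturatedP : ~~ saturated -> exists x y, [/\ x != y, ~~ edge x y &
  forall c, c != x -> c != y -> conn c x y \/
    exists2 z, z != c & ~~ conn c z x /\ ~~ conn c z y].
Proof.
case/forallPn=> x /forallPn[y]; rewrite negb_imply => /andP[xy].
rewrite negb_imply => /andP[nxy /existsPn h].
exists x, y; split=> // c cx cy; move: (h c); rewrite cx cy /=.
have [//|_ /=] := boolP (conn c x y); first by left.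
case/forallPn=> z; rewrite negb_imply negb_or => /and3P[zc nx ny].
by right; exists z.
Qed.

Hypothesis cG : connected G.
Hypothesis satG : saturated.

(** Let [y] and [z] be the neighbours of [c] on geodesics towards [u] and [v]. They are at distance
    2, so saturation separates them, and in G - c they remain connected to [u] and [v]
    respectively. *)
Lemma saturated_between c u v : c != u -> c != v -> between c u v -> ~~ conn c u v.
Proof.
move=> cu cv /eqP bc.
have [i di] : exists i, distance u c = i.+1.
  have : distance u c != 0 by rewrite distance_eq0 // eq_sym.
  by case: (distance u c) => // i _; exists i.
have [j dj] : exists j, distance v c = j.+1.
  have : distance v c != 0 by rewrite distance_eq0 // eq_sym.
  by case: (distance v c) => // j _; exists j.
have [y ey dy] := distance_pred cG di; have [z ez dz] := distance_pred cG dj.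
have dyv : distance y v = (distance c v).+1.
  apply/eqP; rewrite eqn_leq.
  have := distance_triangle cG u y v; have := distance_triangle cG y c v.
  rewrite (distance_edge cG ey); lia.
have dyz : distance y z = 2.
  apply/eqP; rewrite eqn_leq.
  have := distance_triangle cG y z v; have := distance_triangle cG y c z.
  rewrite (distance_edge cG ey) (distance_sym cG c z) (distance_edge cG ez).
  rewrite dyv (distance_sym cG z) (distance_sym cG c) dz dj; lia.
have yz : y != z by rewrite -distance_eq0 // dyz.
have nyz : ~~ edge y z by apply/negP => /(distance_edge cG); rewrite dyz.
have yc := edge_neq ey; have zc := edge_neq ez.
have [c' [c'y c'z nc _]] := (saturatedP satG) y z yz nyz.
(* The separating vertex is [c] itself, because the walk [y], [c], [z] avoids every other vertex. *)
have {c' c'y c'z nc} nyz' : ~~ conn c y z.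
  have [<- //|cc'] := eqVneq c' c.
  case/negP: nc; apply: (@conn_trans _ _ c).
    by apply: conn_edge; rewrite // eq_sym.
  by apply: conn_edge; rewrite 1?edge_sym // eq_sym.
have cuy : conn c u y.
  apply: conn_not_between => //; first by rewrite eq_sym.
  by rewrite /between dy di addSnnS -[X in X == _]addn0 eqn_add2l.
have cvz : conn c v z.
  apply: conn_not_between => //; first by rewrite eq_sym.
  by rewrite /between dz dj addSnnS -[X in X == _]addn0 eqn_add2l.
apply: contra nyz' => cuv; rewrite conn_sym in cuy.
by apply: conn_trans cuy (conn_trans cuv _).
Qed.

(** If they differed, [v] would separate [r] from [x] by [saturated_between], while a geodesic
    through [v'] avoids [v]. *)
Lemma saturated_geodesic_unique r v v' x : between v r x -> between v' r x ->
  distance r v = distance r v' -> v = v'.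
Proof.
move=> bv bv' dvv'; apply/eqP/negPn/negP => vv'.
have vr : v != r.
  apply: contra vv' => /eqP vr; move: dvv'; rewrite vr distance_xx => /esym/eqP.
  by rewrite distance_eq0 // => /eqP ->.
have vx : v != x.
  apply: contra vv' => /eqP vx; move: bv'; rewrite /between -dvv' vx.
  by rewrite -{1}[distance r x]addn0 eqn_add2l eq_sym distance_eq0 // eq_sym.
have := saturated_between vr vx bv; case/negP; move/eqP: bv => bv.
have v'v : v' != v by rewrite eq_sym.
have d0 : distance v' v != 0 by rewrite distance_eq0.
move/eqP: bv' => bv'.
apply: (@conn_trans _ _ v').
  apply: conn_not_between; rewrite 1?eq_sym //.
  rewrite /between -dvv' (distance_sym cG v v'); lia.
rewrite conn_sym; apply: conn_not_between; rewrite 1?eq_sym //.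
rewrite /between (distance_sym cG x v') (distance_sym cG x v) (distance_sym cG v v').
lia.
Qed.

(** If [p] and [u'] were nonadjacent, [u] would lie between them and hence separate them. But
    geodesics from [p] to [r] and from [r] to [u'] avoid [u], which is farther from [r] than [p] and
    as far as [u']. *)
Lemma saturated_common_parent r p u u' : edge u u' -> edge p u ->
  distance r u = distance r u' -> distance r u = (distance r p).+1 -> edge p u'.
Proof.
move=> euu' epu du dp.
have pu' : p != u' by apply/eqP => pu'; move: dp; rewrite du pu'; lia.
apply/negPn/negP => npu'.
have d2 : distance p u' = 2.
  have := distance_triangle cG p u u'.
  rewrite (distance_edge cG epu) (distance_edge cG euu').
  have : distance p u' != 0 by rewrite distance_eq0.
  have : distance p u' != 1.
    by apply: contra npu' => /eqP /(distance1_edge cG).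
  lia.
have up : u != p by rewrite eq_sym edge_neq.
have uu' := edge_neq euu'.
have := @saturated_between u p u' up uu'; rewrite /between d2.
rewrite (distance_edge cG epu) (distance_edge cG euu') => /(_ isT) /negP; case.
have ur : u != r.
  by apply/eqP => ur; move: dp; rewrite ur distance_xx.
have d0 : distance u u' != 0 by rewrite distance_eq0.
apply: (@conn_trans _ _ r); last first.
  apply: conn_not_between; rewrite 1?eq_sym // /between; lia.
rewrite conn_sym; apply: conn_not_between; rewrite 1?eq_sym // /between; lia.
Qed.

End Saturated.

(** * RDD as a sum over ordered pairs, and its growth under added edges *)

Local Open Scope ring_scope.

(* phi 0 = 0, so the diagonal terms of RDD_sum vanish. *)
Definition phi (d : nat) : rat := d%:R^-1.

Lemma phi0 : phi 0 = 0. Proof. by rewrite /phi invr0. Qed.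
Lemma phi1 : phi 1 = 1. Proof. by rewrite /phi invr1. Qed.
Lemma phi_ge0 d : 0 <= phi d. Proof. by rewrite /phi invr_ge0 ler0n. Qed.
Lemma phi_gt0 d : (0 < d)%N -> 0 < phi d.
Proof. by move=> h; rewrite /phi invr_gt0 ltr0n. Qed.
Lemma phi_le d e : (0 < d)%N -> (d <= e)%N -> phi e <= phi d.
Proof.
move=> d0 de; rewrite /phi lef_pV2 ?ler_nat // posrE ltr0n //.
exact: leq_trans de.
Qed.
Lemma phi_lt d e : (0 < d)%N -> (d < e)%N -> phi e < phi d.
Proof.
move=> d0 de; rewrite /phi ltf_pV2 ?ltr_nat // posrE ltr0n //.
exact: leq_trans de.
Qed.

(** The two degrees in the numerator are distributed over the two orders of a pair; the resulting
    sum splits easily into blocks. *)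
Lemma RDD_sum (G : sgraph) : connected G ->
  RDD G = \sum_(x : G) \sum_(y : G) (degree x)%:R * phi (distance x y).
Proof.
move=> cG; rewrite /RDD.
pose f (x y : G) := (degree x)%:R * phi (distance x y).
have -> : \sum_(x : G) \sum_(y : G | (enum_rank x < enum_rank y)%N)
     (degree x + degree y)%:R / (distance x y)%:R =
  \sum_(x : G) \sum_(y : G | (enum_rank x < enum_rank y)%N) f x y +
  \sum_(x : G) \sum_(y : G | (enum_rank x < enum_rank y)%N) f y x.
  rewrite -big_split; apply: eq_bigr => x _; rewrite -big_split.
  apply: eq_bigr => y _; rewrite /f /phi natrD mulrDl.
  by rewrite [distance y x]distance_sym.
rewrite [X in _ + X](exchange_big_dep xpredT) //= -big_split /=.
apply: eq_bigr => x _.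
rewrite [RHS](bigID (fun y => (enum_rank x < enum_rank y)%N)) /=; congr (_ + _).
rewrite [RHS](bigD1 x) ?ltnn //= distance_xx // phi0 mulr0 add0r.
apply: eq_bigl => y; rewrite -leqNgt ltn_neqAle andbC; congr (_ && _).
by congr negb; apply/eqP/eqP => [/ord_inj/enum_rank_inj|->].
Qed.

Section AddEdge.
Variables (G : sgraph) (x y : G).
Hypothesis xy : x != y.

Definition add_edge_rel : rel G :=
  fun u v => [|| edge u v, (u == x) && (v == y) | (u == y) && (v == x)].

Lemma add_edge_sym : symmetric add_edge_rel.
Proof.
move=> u v; rewrite /add_edge_rel edge_sym; congr (_ || _).
by rewrite orbC [in RHS]andbC [(v == y) && _]andbC.
Qed.

Lemma add_edge_irr : irreflexive add_edge_rel.
Proof.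
move=> u; rewrite /add_edge_rel edge_irr /= andbC orbb.
by apply/negP=> /andP[/eqP->]; rewrite eq_sym (negPf xy).
Qed.

Definition add_edge : sgraph := SGraph add_edge_sym add_edge_irr.

Hypothesis cG : connected G.

Lemma connected_add_edge : connected add_edge.
Proof.
move=> u v; apply: connect_sub (cG u v) => a b e; apply: connect1.
by rewrite /= /add_edge_rel e.
Qed.

Lemma distance_add_edge (u v : G) :
  (distance (u : add_edge) v <= distance u v)%N.
Proof.
apply: (proj2 (@distance_retract G add_edge id cG _ u v)) => a b e.
by right; rewrite /= /add_edge_rel e.
Qed.

Lemma degree_add_edge (u : G) : (degree u <= degree (u : add_edge))%N.
Proof.
apply: subset_leq_card; apply/subsetP => v; rewrite !inE => e.
by rewrite /= /add_edge_rel e.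
Qed.

Hypothesis nxy : ~~ edge x y.

Lemma degree_add_edge_lt : (degree x < degree (x : add_edge))%N.
Proof.
apply: proper_card; apply/properP; split.
  by apply/subsetP => v; rewrite !inE /= /add_edge_rel => ->.
by exists y; rewrite !inE //= /add_edge_rel !eqxx orbT.
Qed.

(** Term by term, degrees do not decrease and distances do not increase; the term of the pair (x, y)
    is strictly larger because the degree of [x] grows. *)
Lemma RDD_add_edge : RDD G < RDD add_edge.
Proof.
rewrite (RDD_sum cG) (RDD_sum connected_add_edge).
have le (u v : G) : (degree u)%:R * phi (distance u v) <=
    (degree (u : add_edge))%:R * phi (distance (u : add_edge) v).
  apply: ler_pM; rewrite ?ler0n ?phi_ge0 ?ler_nat ?degree_add_edge //.
  have [->|uv] := eqVneq u v.
    by rewrite distance_xx // distance_xx //; apply: connected_add_edge.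
  apply: phi_le (distance_add_edge u v).
  by rewrite lt0n distance_eq0 //; apply: connected_add_edge.
have dx (u v : add_edge) : u != v -> (0 < distance u v)%N.
  by move=> uv; rewrite lt0n distance_eq0 //; apply: connected_add_edge.
rewrite [ltLHS](bigD1 x) //= [ltRHS](bigD1 x) //=.
apply: ltr_leD; last by apply: ler_sum => u _; apply: ler_sum => v _; apply: le.
rewrite [ltLHS](bigD1 y) //= [ltRHS](bigD1 y) //=.
apply: ltr_leD; last by apply: ler_sum => u _; apply: le.
apply: (@le_lt_trans _ _ ((degree x)%:R * phi (distance (x : add_edge) y))).
  by rewrite ler_wpM2l ?ler0n // phi_le ?distance_add_edge ?dx.
by rewrite ltr_pM2r ?ltr_nat ?degree_add_edge_lt // phi_gt0 // dx.
Qed.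

Lemma num_edges_add_edge :
  (#|[set p : G * G | edge p.1 p.2]| <
   #|[set p : add_edge * add_edge | edge p.1 p.2]|)%N.
Proof.
apply: proper_card; apply/properP; split.
  by apply/subsetP => v; rewrite !inE /= /add_edge_rel => ->.
by exists (x, y); rewrite !inE //= /add_edge_rel !eqxx orbT.
Qed.

Hypothesis keep : forall c, c != x -> c != y -> conn c x y \/
  exists2 z, z != c & ~~ conn c z x /\ ~~ conn c z y.

Lemma conn_add_edge (c u v : G) : conn c u v -> conn (c : add_edge) u v.
Proof.
apply: connect_sub => a b /and3P[e ac bc]; apply: connect1.
by rewrite /avoid /= /add_edge_rel e ac.
Qed.

Lemma conn_add_edge_inv (c u v : G) :
  [|| c == x, c == y | conn c x y] -> conn (c : add_edge) u v -> conn c u v.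
Proof.
move=> h; apply: connect_sub => a b /= /and3P[].
rewrite /= /add_edge_rel => /or3P[e|/andP[/eqP-> /eqP->]|/andP[/eqP-> /eqP->]] ac bc.
- exact: conn_edge.
- by case/or3P: h => [/eqP h|/eqP h|//]; rewrite h eqxx in ac bc.
- rewrite -/(conn c y x) conn_sym.
  by case/or3P: h => [/eqP h|/eqP h|//]; rewrite h eqxx in ac bc.
Qed.

(** Only a [c] separating [x] from [y] could stop being a cut vertex; then [keep] provides a third
    component, which stays separated from [x]. *)
Lemma cut_vertex_add_edge (c : G) : cut_vertex (c : add_edge) = cut_vertex c.
Proof.
apply/(cut_vertexP _ connected_add_edge)/(cut_vertexP _ cG).
  move=> [u [v [uc vc nuv]]]; exists u, v; split=> //.
  by apply: contra nuv; apply: conn_add_edge.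
move=> [u [v [uc vc nuv]]].
have [h|] := boolP [|| c == x, c == y | conn c x y].
  exists u, v; split=> //; apply: contra nuv; exact: conn_add_edge_inv.
rewrite !negb_or => /and3P[cx cy ncxy].
have [|[z zc [nzx nzy]]] := keep cx cy; first by rewrite (negPf ncxy).
exists z, x; split=> //; first by rewrite eq_sym.
apply: contra (nzx) => czx.
(* The component of [z] contains neither end of the new edge, so it remains closed after the
   addition. *)
suff: closed (avoid (c : add_edge)) (conn c z : pred G).
  by move=> cl; rewrite -[conn c z x](closed_connect cl czx) //; apply: connect0.
apply: intro_closed; first exact: sym_connect_sym (@avoid_sym _ _).
move=> a b /and3P[]; rewrite /= /add_edge_rel.
move=> /or3P[e|/andP[/eqP-> _]|/andP[/eqP-> _]] ac bc za.
- exact: conn_trans za (conn_edge e ac bc).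
- by case/negP: nzx.
- by case/negP: nzy.
Qed.

Lemma card_noncut_add_edge :
  #|[set v : add_edge | ~~ cut_vertex v]| = #|[set v : G | ~~ cut_vertex v]|.
Proof.
by apply: eq_card => v; rewrite [LHS]in_set [RHS]in_set cut_vertex_add_edge.
Qed.

End AddEdge.

(** * Layers around a vertex *)

Local Close Scope ring_scope.

Section Root.
Variable G : sgraph.
Hypothesis cG : connected G.
Variable w : G.
Implicit Types x y z c u v p : G.

Local Notation s := (distance w).
Local Notation anc v x := (between v w x).

Definition ends : {set G} := [set x | ~~ cut_vertex x & x != w].
Definition layer i : {set G} := [set x | s x == i].

Lemma root_layer0 : layer 0 = [set w].
Proof. by apply/setP => x; rewrite !inE distance_eq0 // eq_sym. Qed.

Lemma anc_refl x : anc x x.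
Proof. by rewrite /between distance_xx // addn0. Qed.

Lemma anc_trans u v x : anc u v -> anc v x -> anc u x.
Proof.
rewrite /between => /eqP uv /eqP vx; rewrite eqn_leq distance_triangle //=.
by have := distance_triangle cG u v x; lia.
Qed.

Lemma anc_exists x i : i <= s x -> exists2 v, s v = i & anc v x.
Proof. by move=> /(distance_point cG)[v <- /eqP h]; exists v. Qed.

Lemma anc_le u x : anc u x -> s u <= s x.
Proof. by move/eqP => ->; apply: leq_addr. Qed.

Lemma edge_anc u x : edge u x -> s x = (s u).+1 -> anc u x.
Proof. by move=> e sx; rewrite /between sx (distance_edge cG e) addn1. Qed.

Lemma layer_edge u v : edge u v ->
  [\/ s v = s u, s v = (s u).+1 | s u = (s v).+1].
Proof.
move=> e; have := distance_edge_leS cG w e; rewrite edge_sym in e.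
have := distance_edge_leS cG w e => h1 h2.
case: (ltngtP (s u) (s v)) => h; last by constructor 1.
  by constructor 2; lia.
by constructor 3; lia.
Qed.

(* Among the descendants of v, one farthest from w is not a cut vertex. *)
Lemma end_below v : v != w -> exists2 x, x \in ends & anc v x.
Proof.
move=> vw; case: (arg_maxnP (fun x => s x) (anc_refl v)) => x vx max.
exists x => //; rewrite inE; apply/andP; split; last first.
  apply: contra vw => /eqP xw; have := anc_le vx.
  by rewrite xw distance_xx // leqn0 distance_eq0 // eq_sym.
have xw : w != x.
  apply: contra vw => /eqP xw; have := anc_le vx.
  by rewrite -xw distance_xx // leqn0 distance_eq0 // eq_sym.
apply/negP => /(cut_vertexP _ cG)[a [b [ax bx nab]]].
have [y yx nwy] : exists2 y, y != x & ~~ conn x w y.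
  have [wa|] := boolP (conn x w a); last by exists a.
  exists b => //; apply: contra nab => wb; rewrite conn_sym in wa.
  exact: conn_trans wa wb.
have xy : anc x y by apply: contraNT nwy; apply: conn_not_between.
have := max y (anc_trans vx xy); move/eqP: xy => ->.
have : distance x y != 0 by rewrite distance_eq0 // eq_sym.
lia.
Qed.

(** By [end_below] the default value is not reached when [v != w]. *)
Definition end_of v : G := odflt v [pick x in ends | anc v x].

Lemma end_ofP v : v != w -> end_of v \in ends /\ anc v (end_of v).
Proof.
move=> vw; rewrite /end_of; case: pickP => [x /andP[]//|h].
by have [x xe vx] := end_below vw; have := h x; rewrite xe vx.
Qed.

Lemma layer_large i : \max_(x : G) s x < i -> #|layer i| = 0.
Proof.
move=> h; apply: eq_card0 => x; rewrite inE; apply: contraTF h => /eqP <-.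
by rewrite -leqNgt; apply: (@leq_bigmax _ (fun x : G => s x)).
Qed.

Lemma card1_layer i u v : #|layer i| = 1 -> u \in layer i -> v \in layer i -> u = v.
Proof.
by move/eqP/cards1P=> [t ->]; rewrite !inE => /eqP-> /eqP->.
Qed.

Hypothesis satG : saturated G.

Lemma anc_uniq u v x : anc u x -> anc v x -> s u = s v -> u = v.
Proof. exact: saturated_geodesic_unique. Qed.

Lemma anc_comparable u v x : anc u x -> anc v x -> s u <= s v -> anc u v.
Proof.
move=> ux vx /anc_exists[u' su' u'v].
by rewrite (anc_uniq ux (anc_trans u'v vx) (esym su')).
Qed.

(** Choosing an end below each element is injective: an end below two elements makes them equal. *)
Lemma card_antichain (U : {set G}) : w \notin U ->
    (forall u v x, u \in U -> v \in U -> anc u x -> anc v x -> u = v) ->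
  #|U| <= #|ends|.
Proof.
move=> wU hU.
have Uw u : u \in U -> u != w by apply: contraTneq => ->.
rewrite -(@card_in_imset _ _ end_of U); last first.
  move=> u v uU vU e; have [_ hu] := end_ofP (Uw u uU).
  by have [_ hv] := end_ofP (Uw v vU); apply: hU uU vU hu _; rewrite e.
apply: subset_leq_card; apply/subsetP => x /imsetP[u uU ->].
by have [] := end_ofP (Uw u uU).
Qed.

Lemma card_layer i : 0 < i -> #|layer i| <= #|ends|.
Proof.
move=> i0; apply: card_antichain; first by rewrite inE distance_xx // eq_sym -lt0n.
move=> u v x; rewrite !inE => /eqP su /eqP sv ux vx.
by apply: anc_uniq ux vx _; rewrite su sv.
Qed.

Definition stem_length_spec a :=
  (forall i, i <= a -> #|layer i| = 1) /\ 1 < #|layer a.+1|.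

Lemma stem_length_exists : 1 < #|ends| ->
  exists a, stem_length_spec a.
Proof.
move=> ends2.
have ex : exists i, #|layer i.+1| != 1.
  by exists (\max_(x : G) s x); rewrite layer_large.
pose a := ex_minn ex.
have [na mina] : #|layer a.+1| != 1 /\ forall i, #|layer i.+1| != 1 -> a <= i.
  by rewrite /a; case: ex_minnP.
have lea i : i <= a -> #|layer i| = 1.
  case: i => [_|i ia]; first by rewrite root_layer0 cards1.
  by apply/eqP/negPn/negP => /mina; rewrite leqNgt ia.
exists a; split=> //.
(* If layer a + 1 were empty, all vertices would lie in singleton layers, and the nearer of two ends
   would separate [w] from the other, hence be a cut vertex. *)
suff : #|layer a.+1| != 0 by lia.
apply/negP => /eqP/cards0_eq l0.
have sa x : s x <= a.
  rewrite leqNgt; apply/negP => /anc_exists[v sv _].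
  have : v \in layer a.+1 by rewrite inE sv.
  by rewrite l0 inE.
have /card_gt1P[x [y [xe ye xy]]] := ends2.
wlog le : x y xe ye xy / s x <= s y => [hw|].
  have /orP[] := leq_total (s x) (s y); first exact: hw.
  by apply: hw; rewrite // eq_sym.
have [v sv vy] := anc_exists le.
have vx : v = x by apply: (card1_layer (lea _ (sa x))); rewrite inE ?sv.
subst v; move: xe; rewrite inE => /andP[/negP ncx xw]; apply: ncx.
apply/(cut_vertexP _ cG); exists w, y; rewrite eq_sym in xw.
split; rewrite // 1?eq_sym //; apply: saturated_between => //.
by rewrite eq_sym.
Qed.

Definition siblings u : {set G} := [set v | edge u v & s v == s u].
Definition children u : {set G} := [set v | edge u v & s v == (s u).+1].

(** The 1 is for the previous layer: geodesics from [w] pass it in a single point, so it contains at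
    most one neighbour. *)
Lemma degree_siblings_children u : degree u <= 1 + #|siblings u| + #|children u|.
Proof.
apply: (@leq_trans #|[set v | edge u v & s u == (s v).+1] :|: siblings u :|: children u|).
  apply: subset_leq_card; apply/subsetP => y; rewrite !inE => e; rewrite e /=.
  by case: (layer_edge e) => ->; rewrite eqxx ?orbT.
apply: leq_trans (leq_card_setU _ _) _; rewrite leq_add2r.
apply: leq_trans (leq_card_setU _ _) _; rewrite leq_add2r.
apply/card_le1_eqP => x y; rewrite !inE => /andP[ex /eqP sx] /andP[ey /eqP sy].
rewrite edge_sym in ex; rewrite edge_sym in ey.
by apply: (anc_uniq (edge_anc ey sy) (edge_anc ex sx)); lia.
Qed.

Lemma card_parents v : #|[set u | v \in children u]| <= 1.
Proof.
apply/card_le1_eqP => x y; rewrite !inE => /andP[ex /eqP sx] /andP[ey /eqP sy].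
by by apply: (anc_uniq (edge_anc ey sy) (edge_anc ex sx)); lia.
Qed.

Lemma sibling_parent u v : edge u v -> s u = s v ->
  exists2 p, s u = (s p).+1 & anc p u /\ anc p v.
Proof.
move=> e suv; have su : s u != 0.
  apply/eqP => su; have sv : s v = 0 by rewrite -suv.
  move/eqP: su; move/eqP: sv; rewrite !distance_eq0 // => /eqP wv /eqP wu.
  by move: e; rewrite -wv -wu edge_irr.
case E: (s u) su => [//|i] _; have [p ep sp] := distance_pred cG E.
exists p; first by rewrite sp.
split; first by apply: edge_anc; rewrite // E sp.
have epv : edge p v.
  by apply: (saturated_common_parent cG satG e ep (r := w)); rewrite // E sp.
by apply: edge_anc; rewrite // -suv E sp.
Qed.

Section Stem.
Variable a : nat.
Hypothesis stem_layer : forall i, i <= a -> #|layer i| = 1.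
Local Notation q := #|layer a.+1|.

Lemma stem_single x y : s x <= a -> s x = s y -> x = y.
Proof. by move=> xa e; apply: (card1_layer (stem_layer xa)); rewrite inE ?e. Qed.

Lemma stem_anc x y : s x <= a -> s x <= s y -> anc x y.
Proof. by move=> xa /anc_exists[v sv vy]; rewrite (@stem_single x v). Qed.

Lemma stem_exists i : i <= a -> exists t, s t = i.
Proof.
move/stem_layer/eqP/cards1P=> [t tE]; exists t.
by apply/eqP; have := set11 t; rewrite -tE inE.
Qed.

Lemma anc_layer_exists x : a < s x -> exists2 v, v \in layer a.+1 & anc v x.
Proof. by move=> /anc_exists[v sv vx]; exists v; rewrite // inE sv. Qed.

(** The single vertex [t] of layer [a] is adjacent to the whole next layer, so only [t] can separate
    [u] from [v]. If [t] is [w], this contradicts that [w] is not a cut vertex; if not, [w] lies in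
    a third component of G - t, against the last clause of saturation. *)
Lemma layer_clique u v : ~~ cut_vertex w ->
  u \in layer a.+1 -> v \in layer a.+1 -> u != v -> edge u v.
Proof.
rewrite !inE => ncw /eqP su /eqP sv uv; apply/negPn/negP => nuv.
have [c [cu cv nc hz]] := (saturatedP _ satG) u v uv nuv.
have [t st] := stem_exists (leqnn a).
have et x : s x = a.+1 -> edge t x.
  move=> sx; apply: (distance1_edge cG).
  have : anc t x by apply: stem_anc; rewrite st ?sx.
  by rewrite /between st sx => /eqP; lia.
have tc : t = c.
  apply/eqP/negPn/negP => tc; case/negP: nc; apply: (@conn_trans _ _ t).
    by apply: conn_edge; rewrite 1?edge_sym ?et // eq_sym.
  by apply: conn_edge; rewrite ?et // eq_sym.
subst c; have [wt|wt] := eqVneq w t.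
  by case/negP: nc; apply: noncut_conn; rewrite -?wt // eq_sym wt.
have tx x : s x = a.+1 -> t != x -> ~~ conn t w x.
  move=> sx tx; apply: saturated_between => //; first by rewrite eq_sym.
  by apply: stem_anc; rewrite st ?sx.
by have := hz w wt; rewrite (negPf (tx u su cu)) (negPf (tx v sv cv)).
Qed.

Hypothesis branching : 1 < #|layer a.+1|.

(** A vertex of the stem other than [w] lies between [w] and every vertex of layer a + 1, hence is a
    cut vertex. *)
Lemma stem_end_false x : x \in ends -> a < s x.
Proof.
rewrite inE ltnNge => /andP[ncx xw]; apply/negP => xa; move/negP: ncx; apply.
have [v] := card_gt0P (ltnW branching); rewrite inE => /eqP sv.
have xv : x != v by apply/eqP => xv; rewrite xv sv ltnn in xa.
apply/(cut_vertexP _ cG); exists w, v; rewrite eq_sym xw eq_sym xv; split=> //.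
by apply: saturated_between; rewrite // stem_anc // sv; lia.
Qed.

Lemma stem_degree x : s x <= a ->
  degree x <= (0 < s x) + (if s x == a then q else 1).
Proof.
move=> xa; apply: (@leq_trans #|(if s x is i.+1 then layer i else set0) :|: layer (s x).+1|).
  apply: subset_leq_card; apply/subsetP => y; rewrite !inE => e.
  have [sy|->|->] := layer_edge e; last 2 first.
  - by rewrite eqxx orbT.
  - by rewrite inE eqxx.
  by have := edge_neq e; rewrite (stem_single xa (esym sy)) eqxx.
apply: leq_trans (leq_card_setU _ _) _; apply: leq_add.
  by case E: (s x) => [|i]; rewrite ?cards0 // stem_layer //; lia.
case: eqP => [->//|xna]; rewrite stem_layer //; lia.
Qed.

Lemma edge_layer_gt u v : edge u v -> s u = s v -> a < s u.
Proof.
move=> e suv; rewrite ltnNge; apply/negP => ua.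
by have := edge_neq e; rewrite (stem_single ua suv) eqxx.
Qed.

Definition top x : G := odflt x [pick v in layer a.+1 | anc v x].

Lemma topP x : a < s x -> top x \in layer a.+1 /\ anc (top x) x.
Proof.
move=> xa; rewrite /top; case: pickP => [v /andP[]//|h].
by have [v vl vx] := anc_layer_exists xa; have := h v; rewrite vl vx.
Qed.

Lemma top_uniq v x : v \in layer a.+1 -> anc v x -> top x = v.
Proof.
rewrite inE => /eqP sv vx.
have [] := @topP x; first by rewrite -sv; apply: anc_le.
by rewrite inE => /eqP st tx; apply: anc_uniq tx vx _; rewrite st.
Qed.

Lemma top_anc u x : a < s u -> anc u x -> top x = top u.
Proof. by move=> /topP[tl tu] ux; apply: top_uniq => //; apply: anc_trans ux. Qed.

Definition sib_pairs : {set G * G} := [set p | edge p.1 p.2 & s p.1 == s p.2].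

(* Two adjacent vertices u, v of one layer are sent to the pair of ends chosen
   below them; this is injective.  For each end x not chosen below the first
   branching layer, the pair of x with an end in another branch is missed. *)
Lemma card_sib_pairs :
  #|sib_pairs| + (#|ends| - q) <= #|ends| * #|ends|.-1.
Proof.
pose f (p : G * G) := (end_of p.1, end_of p.2).
pose tops := end_of @: layer a.+1.
pose other x := odflt x [pick v in layer a.+1 | v != top x].
pose g x := (x, end_of (other x)).
have nw u : a < s u -> u != w.
  by apply: contraTneq => ->; rewrite distance_xx.
have sibP u v : (u, v) \in sib_pairs -> [/\ edge u v, s u = s v, a < s u & a < s v].
  rewrite inE /= => /andP[e /eqP suv].
  have ua := edge_layer_gt e suv; split=> //; lia.
have otherP x : other x \in layer a.+1 /\ other x != top x.
  rewrite /other; case: pickP => [v /andP[]//|h].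
  have /card_gt1P[y [z [yl zl yz]]] := branching.
  have := h y; have := h z; rewrite yl zl /=.
  by move/negbFE/eqP=> zt /negbFE/eqP yt; rewrite yt zt eqxx in yz.
have la v : v \in layer a.+1 -> a < s v by rewrite inE => /eqP ->.
have top_end u : a < s u -> top (end_of u) = top u.
  by move=> ua; apply: top_anc => //; have [] := end_ofP (nw u ua).
have f_inj : {in sib_pairs &, injective f}.
  move=> [u v] [u' v'] /sibP[e suv ua va] /sibP[e' suv' ua' va'] [/= eu ev].
  wlog le : u v u' v' e suv ua va e' suv' ua' va' eu ev / s u <= s u' => [hw|].
    have /orP[le|le] := leq_total (s u) (s u'); first exact: hw le.
    by symmetry; apply: hw le.
  have [_ hu] := end_ofP (nw u ua); have [_ hv] := end_ofP (nw v va).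
  have [_ hu'] := end_ofP (nw u' ua'); have [_ hv'] := end_ofP (nw v' va').
  rewrite -eu in hu'; rewrite -ev in hv'.
  move: le; rewrite leq_eqVlt => /predU1P[suu'|lt].
    by congr (_, _); [apply: anc_uniq hu hu' _ | apply: anc_uniq hv hv' _]; lia.
  (* When the pairs lie in different layers, the common parent [p] of the deeper pair is below both
     [u] and [v], which forces [u = v]. *)
  have [p sp [pu pv]] := sibling_parent e' suv'.
  have up : anc u p.
    by apply: anc_comparable hu (anc_trans pu hu') _; rewrite -ltnS -sp.
  have vp : anc v p.
    by apply: anc_comparable hv (anc_trans pv hv') _; rewrite -ltnS -sp -suv.
  by have := edge_neq e; rewrite (anc_uniq up vp suv) eqxx.
have disj : [disjoint f @: sib_pairs & g @: (ends :\: tops)].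
  apply/pred0P => -[x y]; apply/negP => /andP[/imsetP[[u v] uv [-> ->]]].
  have [e suv ua va] := sibP _ _ uv.
  case/imsetP=> x' /setDP[xe xt] [xx yy].
  have [ol ot] := otherP x'.
  have := sibling_parent e suv => -[p sp [pu pv]].
  (* Beyond layer a + 1, [u] and [v] have a common parent and thus the same top, whereas [other x']
     lies in another branch. In layer a + 1, the end chosen below [u] belongs to [tops]. *)
  case: (ltngtP (s u) a.+1) => h; first by rewrite ltnS leqNgt ua in h.
    have tuv : top u = top v.
      by rewrite (@top_anc p u) ?(@top_anc p v) // -ltnS -sp.
    case/negP: ot; have -> : top x' = top u by rewrite -xx top_end.
    rewrite tuv -(top_end v) // yy top_end ?la //.
    by rewrite (top_uniq ol (anc_refl _)).
  by case/negP: xt; rewrite -xx; apply: imset_f; rewrite inE h.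
have sub : f @: sib_pairs :|: g @: (ends :\: tops) \subset
    [set p in setX ends ends | p.1 != p.2].
  apply/subsetP => -[x y]; rewrite !inE /=.
  have endE u : a < s u -> end_of u \in ends by move=> /nw /end_ofP[].
  case/orP=> [/imsetP[[u v] /sibP[e suv ua va] [-> ->]] | /imsetP[x' /setDP[xe xt] [-> ->]]].
    have := endE u ua; have := endE v va; rewrite !inE => -> -> /=.
    apply/eqP => euv; have [_ hu] := end_ofP (nw u ua).
    have [_ hv] := end_ofP (nw v va); rewrite -euv in hv.
    by have := edge_neq e; rewrite (anc_uniq hu hv suv) eqxx.
  have [ol ot] := otherP x'; have := endE _ (la _ ol); move: (xe).
  rewrite !inE => -> -> /=; apply/eqP => xo; case/negP: ot.
  by rewrite {2}xo top_end ?la // (top_uniq ol (anc_refl _)).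
have := subset_leq_card sub; rewrite cardsU (disjoint_setI0 disj) cards0 subn0.
rewrite (card_in_imset f_inj) card_imset; last by move=> x y [].
have -> : #|[set p in setX ends ends | p.1 != p.2]| = #|ends| * #|ends|.-1.
  have := cardsID [set p | p.1 != p.2] (setX ends ends).
  have -> : setX ends ends :\: [set p | p.1 != p.2] = [set (x, x) | x in ends].
    apply/setP => -[x y]; rewrite !inE /= negbK; apply/andP/imsetP.
      by move=> [/eqP-> /andP[ye _]]; exists y; rewrite // inE.
    by move=> [z]; rewrite !inE => /andP[nz zw] [-> ->]; rewrite nz zw eqxx.
  have -> : setX ends ends :&: [set p | p.1 != p.2] =
      [set p in setX ends ends | p.1 != p.2] by apply/setP => p; rewrite !inE.
  rewrite cardsX card_imset; last by move=> x y [].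
  by case: #|ends| => [|n] /=; lia.
suff -> : #|ends :\: tops| = #|ends| - q by [].
rewrite cardsD (setIidPr _); last first.
  by apply/subsetP => x /imsetP[v vl ->]; have [] := end_ofP (nw v (la v vl)).
congr (_ - _); apply: card_in_imset => u v ul vl /(congr1 top).
by rewrite !top_end ?la // (top_uniq ul (anc_refl _)) (top_uniq vl (anc_refl _)).
Qed.

End Stem.
End Root.

(** * Removing a pendant path *)

Lemma connect_map (T T' : finType) (e : rel T) (e' : rel T') (f : T -> T') x y :
    (forall x y, e x y -> connect e' (f x) (f y)) ->
  connect e x y -> connect e' (f x) (f y).
Proof.
move=> h /connectP[p + ->]; elim: p x => [|z p IH] x /=; first by rewrite connect0.
by move=> /andP[/h xz /IH]; apply: connect_trans.
Qed.

Section Prune.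
Variable G : sgraph.
Hypothesis cG : connected G.
Hypothesis satG : saturated G.
Variable w : G.
Implicit Types x y z c u v p : G.
Local Notation s := (distance w).
Local Notation anc v x := (between v w x).
Hypothesis ncw : ~~ cut_vertex w.
Variable a : nat.
Hypothesis stem_layer : forall i, i <= a -> #|layer w i| = 1.
Hypothesis branching : 1 < #|layer w a.+1|.
Local Notation q := #|layer w a.+1|.

Definition rest : {set G} := [set x | a < s x].
Local Notation G0 := (induced rest).

Lemma layer_rest z : z \in layer w a.+1 -> z \in rest.
Proof. by rewrite !inE => /eqP ->. Qed.

(* Collapsing the stem onto a vertex z of the first branching layer, which is a
   clique, retracts G onto the rest; hence the rest is isometric in G. *)
Lemma retract_edge (z : G0) x y : val z \in layer w a.+1 -> edge x y ->
  insubd z x = insubd z y \/ @edge G0 (insubd z x) (insubd z y).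
Proof.
wlog: x y / y \in rest -> x \in rest => [hw|hxy] zl e.
  have [xr|xr] := boolP (x \in rest); first exact: hw.
  rewrite edge_sym in e.
  have [|->|e'] := hw y x _ zl e; [by rewrite (negPf xr) | by left |].
  by right; rewrite edge_sym.
rewrite /= !val_insubd; have [yr|yr] := boolP (y \in rest).
  by rewrite (hxy yr); right.
have [xr|xr] := boolP (x \in rest); last first.
  by left; apply: val_inj; rewrite !val_insubd (negPf xr) (negPf yr).
have xl : x \in layer w a.+1.
  move: xr yr (layer_edge cG w e); rewrite !inE -leqNgt => xr yr.
  by case=> h; lia.
have [xz|xz] := eqVneq x (val z).
  by left; apply: val_inj; rewrite !val_insubd xr (negPf yr).
by right; apply: (layer_clique cG satG stem_layer).
Qed.

Lemma rest_top : exists z : G0, val z \in layer w a.+1.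
Proof.
have [z zl] := card_gt0P (ltnW branching).
by exists (Sub z (layer_rest zl)).
Qed.

Lemma connected_rest : connected G0.
Proof.
have [z zl] := rest_top => x y.
have := @distance_retract G G0 (insubd z) cG _ (val x) (val y).
by rewrite !valKd => -[] // u v; apply: retract_edge.
Qed.

Lemma distance_rest (x y : G0) : distance x y = distance (val x) (val y).
Proof.
apply/eqP; rewrite eqn_leq; apply/andP; split.
  have [z zl] := rest_top.
  have := @distance_retract G G0 (insubd z) cG _ (val x) (val y).
  by rewrite !valKd => -[] // u v; apply: retract_edge.
have := @distance_retract G0 G val connected_rest _ x y => -[] // u v e.
by right.
Qed.

(** [x] is an ancestor of both [z] and [c], and [c] is at least as far from [w] as [z], so [c] is
    not between [x] and [z]. *)
Lemma stem_conn x z c : s x <= a -> z \in layer w a.+1 -> c \in rest -> z != c ->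
  conn c x z.
Proof.
rewrite !inE => xa /eqP sz ca zc; apply: conn_not_between => //.
  by apply/eqP => xc; rewrite xc leqNgt ca in xa.
have xz : anc x z by apply: (stem_anc cG stem_layer) => //; lia.
have xc : anc x c by apply: (stem_anc cG stem_layer) => //; lia.
have d0 : distance c z != 0 by rewrite distance_eq0 // eq_sym.
by move: xz xc; rewrite /between => /eqP h1 /eqP h2; apply/eqP; lia.
Qed.

Lemma cut_vertex_rest (c : G0) : cut_vertex c = cut_vertex (val c).
Proof.
(* The stem is collapsed onto a vertex other than [c], so that walks avoiding [c] still avoid it
   afterwards. *)
have [z zl zc] : exists2 z : G0, val z \in layer w a.+1 & z != c.
  have /card_gt1P[x [y [xl yl xy]]] := branching.
  have [xc|xc] := eqVneq (Sub x (layer_rest xl) : G0) c; last by exists (Sub x (layer_rest xl)).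
  by exists (Sub y (layer_rest yl)); rewrite // -xc -val_eqE /= eq_sym.
have avoidE (x y : G0) : avoid c x y = avoid (val c) (val x) (val y).
  by rewrite /avoid /= !val_eqE.
have up (x y : G0) : conn c x y -> conn (val c) (val x) (val y).
  by apply: connect_map => u v; rewrite avoidE; apply: connect1.
have down x y : conn (val c) x y -> conn c (insubd z x) (insubd z y).
  apply: connect_map => u v /and3P[e uc vc].
  have nz x' : x' != val c -> insubd z x' != c.
    by move=> h; rewrite -val_eqE val_insubd; case: ifP; rewrite // val_eqE.
  have [->|e'] := retract_edge zl e; first exact: connect0.
  by apply: conn_edge e' _ _; apply: nz.
apply/(cut_vertexP _ connected_rest)/(cut_vertexP _ cG) => [[x [y [xc yc nxy]]]|].
  exists (val x), (val y); rewrite !val_eqE; split=> //.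
  by apply: contra nxy => /down; rewrite !valKd.
move=> [x [y [xc yc nxy]]]; have nz x' : x' != val c -> insubd z x' != c.
  by move=> h; rewrite -val_eqE val_insubd; case: ifP; rewrite // val_eqE.
exists (insubd z x), (insubd z y); rewrite !nz //; split=> //.
apply: contra nxy => /up h.
have lift x' : x' != val c -> conn (val c) x' (val (insubd z x')).
  move=> x'c; rewrite val_insubd; case: ifPn => [_|]; first exact: connect0.
  rewrite inE -leqNgt => xa.
  by apply: stem_conn; rewrite ?val_eqE // (valP c).
apply: conn_trans (lift x xc) (conn_trans h _).
by rewrite conn_sym lift.
Qed.

Lemma card_noncut_rest : #|[set v : G0 | ~~ cut_vertex v]| = #|ends w|.
Proof.
rewrite -(card_imset _ val_inj); apply: eq_card => x; apply/imsetP/idP.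
  move=> [v]; rewrite !inE cut_vertex_rest => nc ->; rewrite nc /=.
  by apply: contraTneq (valP v) => /= ->; rewrite inE distance_xx.
move=> xe; have xr : x \in rest.
  rewrite inE; exact: (stem_end_false cG satG stem_layer branching xe).
exists (Sub x xr); rewrite // inE cut_vertex_rest /=.
by move: xe; rewrite inE => /andP[].
Qed.

(** The only neighbour that can be lost is the single vertex of layer [a], and only vertices of
    layer a + 1 can be adjacent to it. *)
Lemma degree_rest (x : G0) : degree (val x) <= degree x + (val x \in layer w a.+1).
Proof.
apply: (@leq_trans #|[set y | edge (val x) y & y \in rest] :|:
    [set y | edge (val x) y & y \notin rest]|).
  by apply: subset_leq_card; apply/subsetP => y; rewrite !inE => ->; case: (_ < _).
apply: leq_trans (leq_card_setU _ _) _; apply: leq_add.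
  rewrite /degree -(card_imset _ val_inj); apply: subset_leq_card.
  apply/subsetP => y; rewrite inE => /andP[e yr]; apply/imsetP.
  by exists (Sub y yr); rewrite ?inE.
have xr := valP x; move: xr; rewrite inE => xr.
have out y : y \in [set y | edge (val x) y & y \notin rest] ->
    s y = a /\ val x \in layer w a.+1.
  rewrite !inE -leqNgt => /andP[e ya]; have := layer_edge cG w e => -[] h; lia.
have [xl|xl] := boolP (val x \in layer w a.+1); last first.
  rewrite leqn0 cards_eq0; apply/eqP/setP => y; rewrite in_set0.
  by apply/negP => /out[_]; rewrite (negPf xl).
apply: (@leq_trans #|layer w a|); last by rewrite stem_layer.
apply: subset_leq_card; apply/subsetP => y.
by move=> /out[sy _]; rewrite inE sy.
Qed.

End Prune.

(** * Cliques with attached paths *)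

Local Open Scope ring_scope.

(* The degree of the b-th vertex of a path with M vertices attached to K_m; the
   truncated m - 2 is exact for m > 1. *)
Definition path_degree (m M b : nat) : nat := (1 + (b.+1 < M) + (m - 2) * (b == 0))%N.

(** Ordered pairs from a path with [x] vertices to another with [y] vertices: depths [a] and [b] are
    a + b + 1 apart, across a clique edge. In [inner_sum] both vertices lie on one path, and the
    truncated differences add up to |a - b|. *)
Definition cross_sum (m x y : nat) : rat :=
  \sum_(a < x) \sum_(b < y) (path_degree m x a)%:R * phi (a + b).+1.

Definition inner_sum (m x : nat) : rat :=
  \sum_(a < x) \sum_(b < x) (path_degree m x a)%:R * phi ((a - b) + (b - a)).

(* The value of RDD on the graph obtained from K_m by attaching disjoint paths;
   s lists the numbers of vertices of the paths, the clique vertex included. *)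
Definition paths_RDD (m : nat) (s : seq nat) : rat :=
  \sum_(x <- s) (inner_sum m x - cross_sum m x x) +
  \sum_(x <- s) \sum_(y <- s) cross_sum m x y.

Section CliquePaths.
Variables (m : nat) (l : 'I_m -> nat).
Local Notation H := (clique_paths l).

Definition depth (u : H) : nat := tagged u.

Lemma depth_le (u : H) : (depth u <= l (tag u))%N.
Proof. by rewrite -ltnS; apply: ltn_ord. Qed.

Lemma edge_clique_paths (u v : H) : edge u v =
  if tag u == tag v
  then ((depth u).+1 == depth v) || ((depth v).+1 == depth u)
  else (depth u == 0) && (depth v == 0).
Proof. by []. Qed.

Lemma clique_paths_inj (u v : H) : tag u = tag v -> depth u = depth v -> u = v.
Proof.
rewrite /depth; case: u v => [i x] [j y] /= ij; subst j => e.
by congr existT; apply: val_inj.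
Qed.

Lemma clique_paths_vertex_exists i j : (j <= l i)%N ->
  exists z : H, tag z = i /\ depth z = j.
Proof.
by move=> h; exists (@Tagged _ i (fun i => 'I_(l i).+1) (inord j)); rewrite /depth /= inordK.
Qed.

Definition clique_paths_distance (u v : H) : nat :=
  if tag u == tag v then ((depth u - depth v) + (depth v - depth u))%N
  else (depth u + depth v).+1%N.

(** By [distance_charact]; the predecessor lies one step along the path, or across a clique edge
    when [y] has depth 0 on another path. *)
Lemma clique_paths_distanceP (u v : H) :
  connect edge u v /\ distance u v = clique_paths_distance u v.
Proof.
move: v; apply: distance_charact.
- by rewrite /clique_paths_distance eqxx subnn.
- move=> y z; rewrite edge_clique_paths /clique_paths_distance.
  case: (eqVneq (tag y) (tag z)) => [->|yz].
    by move=> h; case: eqP => _; lia.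
  move=> /andP[/eqP-> /eqP->].
  by case: eqP => [uy|_]; case: eqP => [uz|_]; rewrite ?addn0; lia.
move=> y yu; rewrite /clique_paths_distance.
have ly := depth_le y; have lu := depth_le u.
case: (eqVneq (tag u) (tag y)) => [uy|uy].
  have ne : depth y != depth u.
    by apply: contra yu => /eqP e; apply/eqP; apply: clique_paths_inj.
  rewrite uy in lu; case: (ltnP (depth y) (depth u)) => h.
    have [|z [tz jz]] := @clique_paths_vertex_exists (tag y) (depth y).+1; first by lia.
    exists z; first by rewrite edge_clique_paths tz eqxx jz eqxx orbT.
    by rewrite tz uy eqxx jz; lia.
  have [|z [tz jz]] := @clique_paths_vertex_exists (tag y) (depth y).-1; first by lia.
  exists z; first by rewrite edge_clique_paths tz eqxx jz; apply/orP; left; lia.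
  by rewrite tz uy eqxx jz; lia.
case: (posnP (depth y)) => y0.
  have [|z [tz jz]] := @clique_paths_vertex_exists (tag u) 0; first by [].
  exists z; first by rewrite edge_clique_paths tz (negPf uy) jz y0.
  by rewrite tz eqxx jz y0; lia.
have [|z [tz jz]] := @clique_paths_vertex_exists (tag y) (depth y).-1; first by lia.
exists z; first by rewrite edge_clique_paths tz eqxx jz; apply/orP; left; lia.
by rewrite tz (negPf uy) jz; lia.
Qed.

Lemma connected_clique_paths : connected H.
Proof. by move=> u v; have [] := clique_paths_distanceP u v. Qed.

Lemma sum_clique_paths (R : nmodType) (f : H -> R) :
  \sum_(u : H) f u =
  \sum_(i < m) \sum_(a < (l i).+1) f (Tagged (fun i => 'I_(l i).+1) a).
Proof.
rewrite sig_big_dep /=.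
by apply: eq_bigr => -[i a] _.
Qed.

Lemma degree_clique_paths (u : H) : (1 < m)%N ->
  degree u = path_degree m (l (tag u)).+1 (depth u).
Proof.
move=> m1; rewrite /degree -sum1_card big_mkcond /=.
under eq_bigr do rewrite inE.
rewrite (@sum_clique_paths nat) (bigD1 (tag u)) //=.
under eq_bigr do rewrite /clique_paths_edge /= eqxx.
(* Another path contains a neighbour of [u] only if [u] is a clique vertex, and then just its own
   clique vertex. *)
rewrite [X in _ + X](eq_bigr (fun i => (depth u == 0) : nat)); last first.
  move=> i iu; rewrite (bigD1 ord0) //= big1 ?addn0.
    rewrite /clique_paths_edge /= eq_sym (negPf iu) andbT.
    by rewrite -/(depth u); case: (_ == _).
  move=> b; rewrite -val_eqE /= => b0.
  by rewrite /clique_paths_edge /= eq_sym (negPf iu) (negPf b0) andbF.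
rewrite sum_nat_const /= (eq_card (B := predC1 (tag u))) // cardC1 card_ord.
have : (depth u < (l (tag u)).+1)%N by apply: ltn_ord.
rewrite -/(depth u); move: (depth u) => t; move: (l (tag u)).+1 => L ltu.
have -> : (\sum_(a < L) (if (t.+1 == a) || (a.+1 == t) then 1 else 0) =
   (t.+1 < L) + (0 < t))%N.
  rewrite (eq_bigr (fun a : 'I_L => (t.+1 == a) + (a.+1 == t))%N); last first.
    by move=> a _; case: eqP => h1; case: eqP => h2 //; lia.
  rewrite big_split /=; congr (_ + _)%N.
    case: (ltnP t.+1 L) => h; last by rewrite big1 // => a _; have := ltn_ord a; lia.
    rewrite (bigD1 (Ordinal h)) //= eqxx big1 // => a.
    by rewrite -val_eqE /= eq_sym => /negPf ->.
  case: (posnP t) => h; first by rewrite big1 // => a _; lia.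
  have h' : (t.-1 < L)%N by lia.
  rewrite (bigD1 (Ordinal h')) //= prednK // eqxx big1 // => a.
  by rewrite -val_eqE /= => h2; lia.
by rewrite /path_degree; case: t ltu => [|t] ltu; rewrite /= ?muln1 ?muln0; case: (_ < L)%N; lia.
Qed.

Lemma RDD_clique_paths : (1 < m)%N ->
  RDD H = paths_RDD m [seq (l i).+1 | i <- enum 'I_m].
Proof.
move=> m1; rewrite (RDD_sum connected_clique_paths).
rewrite (@sum_clique_paths rat).
pose K (i j : 'I_m) := if i == j then inner_sum m (l i).+1
  else cross_sum m (l i).+1 (l j).+1.
transitivity (\sum_(i < m) \sum_(j < m) K i j).
  apply: eq_bigr => i _.
  under eq_bigr do rewrite (@sum_clique_paths rat).
  rewrite exchange_big /=; apply: eq_bigr => j _; rewrite /K.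
  case: (eqVneq i j) => [<-|ij]; apply: eq_bigr => a _; apply: eq_bigr => b _.
    rewrite degree_clique_paths //; congr (_ * phi _).
    by rewrite (proj2 (clique_paths_distanceP _ _)) /clique_paths_distance /= eqxx.
  rewrite degree_clique_paths //; congr (_ * phi _).
  by rewrite (proj2 (clique_paths_distanceP _ _)) /clique_paths_distance /= (negPf ij).
rewrite /paths_RDD big_map big_enum [X in _ + X]big_map [X in _ + X]big_enum.
rewrite -big_split /=; apply: eq_bigr => i _.
rewrite big_map big_enum /= (bigD1 i) // [in RHS](bigD1 i) //= {1}/K eqxx.
rewrite addrA subrK; congr (_ + _); apply: eq_bigr => j ji.
by rewrite /K eq_sym (negPf ji).
Qed.

End CliquePaths.

(** * Moving a vertex from one path to another *)

Lemma paths_RDD_perm m s t : perm_eq s t -> paths_RDD m s = paths_RDD m t.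
Proof.
move=> st; rewrite /paths_RDD (perm_big _ st) /=; congr (_ + _).
by rewrite (perm_big _ st) /=; apply: eq_bigr => x _; rewrite (perm_big _ st).
Qed.

Lemma paths_RDD_cons m x s : paths_RDD m (x :: s) =
  inner_sum m x + \sum_(y <- s) (cross_sum m x y + cross_sum m y x) +
  paths_RDD m s.
Proof.
rewrite /paths_RDD !big_cons [X in _ + (_ + X)](eq_bigr (fun y =>
  cross_sum m y x + \sum_(z <- s) cross_sum m y z)); last first.
  by move=> y _; rewrite big_cons.
by rewrite !big_split /=; ring.
Qed.

(** Gain from extending a path at its end, for the vertex at distance [t] from the old end. That
    vertex has degree 2 and the new end degree 1, at distance t + 1, whence the coefficient 3; the
    degree of the old end grows by one, whence [phi t]. *)
Definition step_weight (t : nat) : rat := 3%:R * phi t.+1 + phi t.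

Lemma sum_phi_rev x : \sum_(b < x) phi (x - b) = \sum_(b < x) phi b.+1.
Proof.
rewrite (reindex_inj rev_ord_inj) /=; apply: eq_bigr => b _.
by congr phi; have := ltn_ord b; lia.
Qed.

Lemma sum_phi_rev_pred x : \sum_(b < x.+1) phi ((x - b) + (b - x)) = \sum_(b < x.+1) phi b.
Proof.
rewrite (reindex_inj rev_ord_inj) /=; apply: eq_bigr => b _.
by congr phi; have := ltn_ord b; lia.
Qed.

Lemma path_degreeS m x a : (a <= x)%N ->
  path_degree m x.+2 a = (path_degree m x.+1 a + (a == x))%N.
Proof. by rewrite /path_degree => h; case: eqP => e; lia. Qed.

(** The last term accounts for the m - 2 further clique neighbours of the vertex of depth 0. *)
Lemma inner_sumS m x : inner_sum m x.+2 =
  inner_sum m x.+1 + \sum_(t < x.+1) step_weight t + (m - 2)%:R * phi x.+1.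
Proof.
rewrite /inner_sum big_ord_recr /= [X in _ + X = _]big_ord_recr /= subnn phi0 mulr0 addr0.
have -> : path_degree m x.+2 x.+1 = 1%N by rewrite /path_degree /= ltnn muln0.
rewrite (eq_bigr (fun a : 'I_x.+1 =>
   \sum_(b < x.+1) (path_degree m x.+1 a)%:R * phi ((a - b) + (b - a)) +
   (\sum_(b < x.+1) (if a == ord_max then phi ((x - b) + (b - x)) else 0) +
    (2%:R + ((m - 2) * (a == 0 :> nat))%N%:R) * phi (x.+1 - a)))); last first.
  move=> a _; have lea := ltn_ord a; rewrite big_ord_recr /= addrA; congr (_ + _).
    rewrite -big_split /=; apply: eq_bigr => b _; rewrite path_degreeS //.
    rewrite -val_eqE /=; case: eqP => [->|_]; last by rewrite addn0 addr0.
    by rewrite natrD mulrDl mul1r.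
  rewrite -natrD; congr (_%:R * phi _); last by lia.
  by rewrite /path_degree; lia.
rewrite !big_split /= -!addrA; congr (_ + _).
rewrite [X in X + _](bigD1 ord_max) //= [X in _ + X + _]big1 ?addr0; last first.
  by move=> a /negPf h; rewrite big1 // => b _; rewrite h.
under eq_bigr do rewrite eqxx.
rewrite sum_phi_rev_pred.
have -> : \sum_(a < x.+1) (2%:R + ((m - 2) * (a == 0 :> nat))%N%:R) * phi (x.+1 - a) =
   2%:R * \sum_(b < x.+1) phi b.+1 + (m - 2)%:R * phi x.+1.
  under eq_bigr do rewrite mulrDl.
  rewrite big_split /= -mulr_sumr sum_phi_rev; congr (_ + _).
  rewrite big_ord_recl /= muln1 subn0 big1 ?addr0 // => i _.
  by rewrite /= muln0 mul0r.
have -> : \sum_(b < x.+1) 1%:R * phi (x.+1 - b + (b - x.+1)) =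
    \sum_(b < x.+1) phi b.+1.
  rewrite -sum_phi_rev; apply: eq_bigr => b _; rewrite mul1r; congr phi.
  by have := ltn_ord b; lia.
by rewrite -mulr_sumr; ring.
Qed.

Lemma cross_sumSl m x y : cross_sum m x.+2 y =
  cross_sum m x.+1 y + \sum_(b < y) (phi (x + b).+2 + phi (x + b).+1).
Proof.
rewrite /cross_sum big_ord_recr /=.
have -> : path_degree m x.+2 x.+1 = 1%N by rewrite /path_degree /= ltnn muln0.
rewrite (eq_bigr (fun a : 'I_x.+1 =>
   \sum_(b < y) (path_degree m x.+1 a)%:R * phi (a + b).+1 +
   (if a == ord_max then \sum_(b < y) phi (x + b).+1 else 0))); last first.
  move=> a _; have lea := ltn_ord a.
  rewrite -val_eqE path_degreeS //=; case: eqP => [->|_]; last by rewrite addn0 addr0.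
  by rewrite -big_split /=; apply: eq_bigr => b _; rewrite natrD mulrDl mul1r.
rewrite big_split /= -addrA; congr (_ + _).
rewrite (bigD1 ord_max) //= eqxx [X in _ + X + _]big1 ?addr0; last first.
  by move=> a /negPf ->.
rewrite addrC -big_split /=; apply: eq_bigr => b _.
by rewrite mul1r addSn.
Qed.

Lemma cross_sumSr m x y : cross_sum m y x.+1 =
  cross_sum m y x + \sum_(b < y) (path_degree m y b)%:R * phi (x + b).+1.
Proof.
rewrite /cross_sum -big_split /=; apply: eq_bigr => a _.
by rewrite big_ord_recr /= [(x + a)%N]addnC.
Qed.

(** Change of both cross sums with a path of [z] vertices when the other path grows from x + 1 to x
    + 2 vertices: the new end against depth [b] in both orders, then the increased degree of the old
    end. *)
Definition cross_step (m x z : nat) : rat :=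
  \sum_(b < z) ((1 + path_degree m z b)%:R * phi (x + b).+2 + phi (x + b).+1).

Lemma paths_RDD_step m x s : paths_RDD m (x.+2 :: s) = paths_RDD m (x.+1 :: s) +
  (\sum_(t < x.+1) step_weight t + (m - 2)%:R * phi x.+1 +
   \sum_(z <- s) cross_step m x z).
Proof.
rewrite !paths_RDD_cons inner_sumS.
rewrite [X in _ + X + _](eq_bigr (fun y => (cross_sum m x.+1 y + cross_sum m y x.+1) +
  cross_step m x y)); first by rewrite [X in _ + X + _]big_split /=; ring.
move=> y _; rewrite cross_sumSl cross_sumSr addrACA; congr (_ + _).
rewrite -big_split /=; apply: eq_bigr => b _.
by rewrite natrD mulrDl mul1r addSn; ring.
Qed.

(* Lengthening one of two attached paths extends their union, itself a path, by
   one vertex: only the terms of the two clique vertices depend on which one. *)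
Lemma cross_step_sym m x y :
  \sum_(t < x.+1) step_weight t + cross_step m x y.+1 =
  \sum_(t < x + y + 2) step_weight t + (m - 2)%:R * phi x.+2 - phi (x + y).+2.
Proof.
(* Each [b] contributes a step weight, with two corrections: the clique vertex b = 0 has m - 2 more
   neighbours, and the end b = y has one fewer. *)
have -> : cross_step m x y.+1 = \sum_(b < y.+1) step_weight (x.+1 + b) +
     (m - 2)%:R * phi x.+2 - phi (x + y).+2.
  rewrite /cross_step (eq_bigr (fun b : 'I_y.+1 => step_weight (x.+1 + b) +
    (((m - 2) * (b == 0 :> nat))%N%:R * phi x.+2 -
     (if b == ord_max then phi (x + y).+2 else 0)))); last first.
    move=> b _; rewrite /step_weight /path_degree !(addSn x b).
    have e0 : ((m - 2) * (b == 0 :> nat))%N%:R * phi x.+2 =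
       ((m - 2) * (b == 0 :> nat))%N%:R * phi (x + b).+2.
      by case: (nat_of_ord b) => [|n]; rewrite ?addn0 // muln0 !mul0r.
    rewrite e0 !natrD -val_eqE /= ltnS; have := ltn_ord b; rewrite ltnS leq_eqVlt.
    case: eqP => [->|_]; first by rewrite ltnn /= => _; ring.
    by move=> /= -> /=; ring.
  rewrite big_split /= sumrB -addrA; congr (_ + (_ - _)).
    rewrite big_ord_recl /= muln1 big1 ?addr0 // => i _.
    by rewrite /= muln0 mul0r.
  by rewrite (bigD1 ord_max) //= eqxx big1 ?addr0 // => a /negPf ->.
rewrite !addrA; congr (_ + _ - _).
have -> : (x + y + 2 = x.+1 + y.+1)%N by lia.
by rewrite big_split_ord.
Qed.

Lemma cross_step_le m x y z : (y <= x)%N -> cross_step m x z <= cross_step m y z.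
Proof.
move=> yx; apply: ler_sum => b _; apply: lerD; last by apply: phi_le; lia.
by rewrite ler_wpM2l ?ler0n // phi_le //; lia.
Qed.

(** Both configurations extend x + 1, y + 1 by one vertex. By [cross_step_sym] the two paths
    concerned differ only in terms with factor m - 2, and every other path gains at least as much
    when the shorter one is extended. *)
Lemma paths_RDD_move m x y s : (y < x)%N ->
  paths_RDD m (x.+2 :: y.+1 :: s) +
    (m - 2)%:R * (phi y.+1 - phi x.+1 + (phi y.+2 - phi x.+2)) <=
  paths_RDD m (x.+1 :: y.+2 :: s).
Proof.
move=> yx; rewrite paths_RDD_step.
have swap a b : perm_eq (a :: b :: s) (b :: a :: s).
  by apply/seq.permP => p /=; rewrite addnCA.
rewrite (paths_RDD_perm m (swap x.+1 y.+2)) paths_RDD_step.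
rewrite (paths_RDD_perm m (swap y.+1 x.+1)) !big_cons.
have hx := cross_step_sym m x y; have hy := cross_step_sym m y x.
rewrite [(y + x)%N]addnC in hy.
have le : \sum_(z <- s) cross_step m x z <= \sum_(z <- s) cross_step m y z.
  by apply: ler_sum => z _; apply: cross_step_le; apply: ltnW.
move: hx hy le.
by move=> hx hy le; nra.
Qed.

Local Close Scope ring_scope.

(** * Balanced sequences *)

Definition almost_equal (s : seq nat) := forall x y, x \in s -> y \in s -> x <= y.+1.

(** [b] is the minimum. As it occurs, fewer than [size s] entries equal b + 1, so [b] and their
    number are the quotient and remainder of the sum by the size. *)
Lemma almost_equal_count s : almost_equal s -> 0 < size s -> exists b,
  [/\ forall x, x \in s -> x = b \/ x = b.+1, count_mem b s + count_mem b.+1 s = size s,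
      sumn s = size s * b + count_mem b.+1 s & count_mem b.+1 s < size s].
Proof.
move=> ae s0; have [b bs minb] : exists2 b, b \in s & forall x, x \in s -> b <= x.
  case: s s0 {ae} => [//|z s _]; elim: s z => [|y s IH] z.
    by exists z; rewrite ?mem_head // => x; rewrite inE => /eqP ->.
  have [b bs minb] := IH y; case: (leqP z b) => h.
    exists z; rewrite ?mem_head // => x; rewrite inE => /predU1P[->//|/minb].
    exact: leq_trans.
  exists b; first by rewrite inE bs orbT.
  by move=> x; rewrite inE => /predU1P[->|/minb//]; apply: ltnW.
have two x : x \in s -> x = b \/ x = b.+1.
  by move=> xs; have := minb x xs; have := ae x b xs bs; lia.
have cnt : count_mem b s + count_mem b.+1 s = size s.
  have : forall x, x \in s -> x = b \/ x = b.+1 by [].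
  elim: (s) => [//|y r IH] h /=; rewrite -IH; last first.
    by move=> x xr; apply: h; rewrite inE xr orbT.
  by case: (h y (mem_head _ _)) => -> /=; rewrite ?eqxx ?(gtn_eqF (ltnSn b)) ?(ltn_eqF (ltnSn b)); lia.
exists b; split=> //; last first.
  by rewrite -cnt -[ltnLHS]add0n ltn_add2r -has_count has_pred1.
have : forall x, x \in s -> x = b \/ x = b.+1 by [].
elim: (s) => [//|y r IH] h /=.
rewrite IH; last by move=> x xr; apply: h; rewrite inE xr orbT.
by case: (h y (mem_head _ _)) => -> /=; rewrite ?eqxx ?(gtn_eqF (ltnSn b)) ?(ltn_eqF (ltnSn b)); lia.
Qed.

Lemma almost_equal_perm s t : almost_equal s -> almost_equal t ->
  size s = size t -> sumn s = sumn t -> perm_eq s t.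
Proof.
move=> aes aet sz sm; have [s0|s0] := posnP (size s).
  have /size0nil -> : size t = 0 by rewrite -sz.
  by rewrite (size0nil s0).
have t0 : 0 < size t by rewrite -sz.
have [b [bs cs ss ls]] := almost_equal_count aes s0.
have [c [bt ct st lt]] := almost_equal_count aet t0.
have bc : b = c.
  move: sm; rewrite ss st -sz => e; rewrite -sz in lt.
  case: (ltngtP b c) => // h; exfalso.
    have : size s * b.+1 <= size s * c by rewrite leq_mul2l h orbT.
    by rewrite mulnS; lia.
  have : size s * c.+1 <= size s * b by rewrite leq_mul2l h orbT.
  by rewrite mulnS; lia.
subst c; have e1 : count_mem b.+1 s = count_mem b.+1 t.
  by move: sm; rewrite ss st sz; lia.
have e0 : count_mem b s = count_mem b t by lia.
apply/allP => x; rewrite mem_cat /= => xst.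
by case: (orP xst) => [/bs|/bt] [] ->; rewrite ?e0 ?e1.
Qed.

Lemma almost_equalPn s : ~ almost_equal s ->
  exists x y r, perm_eq s (x :: y :: r) /\ y.+1 < x.
Proof.
move=> nae; have /hasP[x xs /hasP[y ys xy]] : has (fun x => has (fun y => y.+1 < x) s) s.
  apply/negPn/negP => /hasPn h; apply: nae => x y xs ys.
  by have /hasPn/(_ y ys) := h x xs; rewrite -leqNgt.
have yx : y != x by apply/eqP => e; rewrite e in xy; lia.
exists x, y, (rem y (rem x s)); split=> //.
apply: perm_trans (perm_to_rem xs) _; rewrite perm_cons.
apply: perm_to_rem; have := perm_mem (perm_to_rem xs) y.
by rewrite ys inE (negPf yx) /= => <-.
Qed.

(** While two entries differ by more than one, [paths_RDD_move] levels them and the sum of squares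
    decreases. The gain carries the factor m - 2, positive for m > 2. *)
Lemma paths_RDD_balanced m s t : 1 < m -> all (leq 1) s -> almost_equal t ->
    size s = size t -> sumn s = sumn t ->
  (paths_RDD m s <= paths_RDD m t)%R /\
  (2 < m -> paths_RDD m s = paths_RDD m t -> perm_eq s t).
Proof.
move=> m1; have [n] := ubnP (sumn [seq x ^ 2 | x <- s]).
elim: n s => [//|n IH] s lt s1 aet sz sm.
have dec : decidable (almost_equal s).
  have [h|h] := boolP (all (fun x => all (fun y => x <= y.+1) s) s).
    by left=> x y xs ys; move/allP/(_ x xs)/allP/(_ y ys): h.
  by right=> ae; case/negP: h; apply/allP => x xs; apply/allP => y ys; apply: ae.
case: dec => [aes|/almost_equalPn[x [y [r [sp xy]]]]].
  have st := almost_equal_perm aes aet sz sm.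
  by rewrite (paths_RDD_perm m st).
have y1 : 0 < y.
  by move/allP/(_ y): s1; apply; rewrite (perm_mem sp) !inE eqxx orbT.
case: x xy sp => [//|[//|x]] xy sp; case: y y1 xy sp => [//|y] _ xy sp.
have xy' : y < x by lia.
have [] := IH (x.+1 :: y.+2 :: r); rewrite //=.
- have := perm_sumn (perm_map (fun x => x ^ 2) sp) => /= e.
  move: lt; rewrite e /= => lt.
  have : x.+1 ^ 2 + y.+2 ^ 2 < x.+2 ^ 2 + y.+1 ^ 2 by rewrite !expnS !expn0; nia.
  lia.
- by move: s1; rewrite (perm_all _ sp) /=.
- by rewrite -sz (perm_size sp).
- by rewrite -sm (perm_sumn sp) /=; lia.
have mv := paths_RDD_move m r xy'; rewrite -(paths_RDD_perm m sp) in mv.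
have d0 : (0 < phi y.+1 - phi x.+1 + (phi y.+2 - phi x.+2))%R.
  by apply: addr_gt0; rewrite subr_gt0; apply: phi_lt.
move=> le eqP; split.
  apply: le_trans le; apply: le_trans mv; rewrite lerDl.
  by rewrite mulr_ge0 ?ler0n // ltW.
move=> m2 e; exfalso; move: le; rewrite -e => le.
have := le_trans mv le; rewrite gerDl leNgt mulr_gt0 //.
by rewrite ltr0n; lia.
Qed.

(** * Comparing layer sizes *)

Local Open Scope ring_scope.

Definition depth_sum (s : seq nat) (f : nat -> rat) : rat :=
  \sum_(x <- s) \sum_(b < x) f b.

(** The total reciprocal distance from a vertex to a pendant path of [x] vertices whose nearest one
    is at distance [e]. *)
Definition shift_phi (x e : nat) : rat := \sum_(j < x) phi (j + e).

Lemma path_degree_mS m M b : (1 < m)%N ->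
  path_degree m.+1 M b = (path_degree m M b + (b == 0))%N.
Proof. by rewrite /path_degree => m1; case: (b == 0); lia. Qed.

(** Each of the [m] clique vertices gains one in degree; a vertex of depth [b] has one of them at
    distance [b] and the m - 1 others at b + 1. *)
Lemma paths_RDD_mS m s : (1 < m)%N -> size s = m -> all (leq 1) s ->
  paths_RDD m.+1 s = paths_RDD m s +
    (depth_sum s phi + (m.-1)%:R * depth_sum s (fun b => phi b.+1)).
Proof.
move=> m1 sz s1.
have pos x : x \in s -> (0 < x)%N by move/allP: s1 => h /h.
have innerE x : (0 < x)%N -> inner_sum m.+1 x = inner_sum m x + \sum_(b < x) phi b.
  case: x => [//|x] _; rewrite /inner_sum.
  under eq_bigr do under eq_bigr do rewrite path_degree_mS // natrD mulrDl.
  under eq_bigr do rewrite big_split.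
  rewrite big_split /=; congr (_ + _).
  rewrite big_ord_recl /= [X in _ + X]big1 ?addr0; last first.
    by move=> i _; rewrite big1 // => b _; rewrite mul0r.
  by apply: eq_bigr => b _; rewrite mul1r sub0n add0n subn0.
have crossE x y : (0 < x)%N -> cross_sum m.+1 x y = cross_sum m x y + \sum_(b < y) phi b.+1.
  case: x => [//|x] _; rewrite /cross_sum.
  under eq_bigr do under eq_bigr do rewrite path_degree_mS // natrD mulrDl.
  under eq_bigr do rewrite big_split.
  rewrite big_split /=; congr (_ + _).
  rewrite big_ord_recl /= [X in _ + X]big1 ?addr0; last first.
    by move=> i _; rewrite big1 // => b _; rewrite mul0r.
  by apply: eq_bigr => b _; rewrite mul1r.
rewrite /paths_RDD.
have -> : \sum_(x <- s) \sum_(y <- s) cross_sum m.+1 x y =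
   \sum_(x <- s) \sum_(y <- s) cross_sum m x y + m%:R * depth_sum s (fun b => phi b.+1).
  rewrite (eq_big_seq (fun x => \sum_(y <- s) cross_sum m x y + depth_sum s (fun b => phi b.+1))).
    by rewrite big_split big_const_seq count_predT sz iter_addr_0 mulr_natl.
  move=> x xs; rewrite -big_split; apply: eq_bigr => y _; apply: crossE; exact: pos.
rewrite (eq_big_seq (fun x => (inner_sum m x - cross_sum m x x) +
   (\sum_(b < x) phi b - \sum_(b < x) phi b.+1))); last first.
  by move=> x xs; rewrite (innerE _ (pos x xs)) (crossE _ _ (pos x xs)); ring.
rewrite big_split /= !sumrB -/(depth_sum s phi) -/(depth_sum s (fun b => phi b.+1)).
have -> : m%:R = (m.-1)%:R + 1 :> rat by rewrite natr1 prednK // ltnW.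
by ring.
Qed.

(** The terms are grouped so that each matches one block of [RDD_split]. *)
Lemma paths_RDD_extend m x s : (1 < m)%N -> size s = m -> all (leq 1) s ->
  paths_RDD m.+1 (x :: s) = paths_RDD m s + inner_sum m.+1 x +
    (depth_sum s phi + (m.-1)%:R * depth_sum s (fun b => phi b.+1)) +
    \sum_(j < x) (path_degree m.+1 x j)%:R * depth_sum s (fun b => phi (j + b.+1)) +
    \sum_(y <- s) \sum_(b < y) (path_degree m.+1 y b)%:R * shift_phi x b.+1.
Proof.
move=> m1 sz s1; rewrite paths_RDD_cons paths_RDD_mS // big_split /=.
have -> : \sum_(y <- s) cross_sum m.+1 x y =
    \sum_(j < x) (path_degree m.+1 x j)%:R * depth_sum s (fun b => phi (j + b.+1)).
  rewrite /cross_sum exchange_big; apply: eq_bigr => j _.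
  rewrite /depth_sum mulr_sumr; apply: eq_bigr => y _.
  by rewrite mulr_sumr; apply: eq_bigr => b _; rewrite addnS.
have -> : \sum_(y <- s) cross_sum m.+1 y x =
    \sum_(y <- s) \sum_(b < y) (path_degree m.+1 y b)%:R * shift_phi x b.+1.
  apply: eq_bigr => y _; apply: eq_bigr => b _; rewrite /shift_phi mulr_sumr.
  by apply: eq_bigr => j _; rewrite addnS addnC.
by ring.
Qed.

(** The degree is 1, plus one if the path continues, plus m - 1 at depth 0. The second part is a sum
    over depths at least 1; writing it with [maxn 1 b] keeps it a [depth_sum] of a function monotone
    from 0 on, at the price of [m] copies of [f 1]. *)
Lemma depth_sum_path_degree m s (f : nat -> rat) : size s = m -> all (leq 1) s ->
    (1 < m)%N ->
  \sum_(y <- s) \sum_(b < y) (path_degree m.+1 y b)%:R * f b.+1 =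
  depth_sum s (fun b => f b.+1) + depth_sum s (fun b => f (maxn 1 b)) - m%:R * f 1%N +
  (m * m.-1)%:R * f 1%N.
Proof.
move=> sz s1 m1.
have pos x : x \in s -> (0 < x)%N by move/allP: s1 => h /h.
have [c cE] : exists c, c = (m.-1)%:R * f 1%N - f 1%N by exists ((m.-1)%:R * f 1%N - f 1%N).
rewrite (eq_big_seq (fun y => \sum_(b < y) f b.+1 + \sum_(b < y) f (maxn 1 b) + c)).
  rewrite !big_split /= big_const_seq count_predT sz iter_addr_0.
  by rewrite /depth_sum -[_ *+ m]mulr_natl cE natrM; ring.
move=> y ys; have := pos y ys; case: y {ys} => [//|y] _; rewrite {c}cE.
have e1 : \sum_(b < y.+1) f (maxn 1 b) = f 1%N + \sum_(b < y) f b.+1.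
  by rewrite big_ord_recl; congr (f _ + _); apply: eq_bigr => b _; congr f; rewrite /= /bump; lia.
have e2 : \sum_(b < y.+1) (b.+1 < y.+1)%N%:R * f b.+1 = \sum_(b < y) f b.+1.
  rewrite big_ord_recr /= ltnn mul0r addr0; apply: eq_bigr => b _.
  by rewrite ltnS ltn_ord mul1r.
have e3 : \sum_(b < y.+1) ((m.-1 * (b == 0 :> nat))%N)%:R * f b.+1 = (m.-1)%:R * f 1%N.
  rewrite big_ord_recl /= muln1 big1 ?addr0 // => b _.
  by rewrite muln0 mul0r.
rewrite (eq_bigr (fun b : 'I_y.+1 => f b.+1 + (b.+1 < y.+1)%N%:R * f b.+1 +
    ((m.-1 * (b == 0 :> nat))%N)%:R * f b.+1)); last first.
  move=> b _; rewrite /path_degree !natrD !mulrDl mul1r; congr (_ + _ + _%:R * _).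
  by congr muln; lia.
by rewrite big_split e3 big_split e2 e1 /=; ring.
Qed.

Section Dominate.
Variables (T : finType) (B : {set T}) (t : T -> nat) (m : nat) (s : seq nat).
Hypothesis sz : size s = m.
Hypothesis s1 : all (leq 1) s.
Hypothesis aes : almost_equal s.
Hypothesis m0 : (0 < m)%N.
Hypothesis sm : sumn s = #|B|.
Hypothesis fiber : forall i, (#|[set u in B | t u == i]| <= m)%N.

Lemma sum_const_size (c : rat) : m%:R * c = \sum_(x <- s) c.
Proof. by rewrite big_const_seq count_predT sz iter_addr_0 mulr_natl. Qed.

(* The layers of a balanced sequence have the maximal size m up to the last one,
   hence t cannot be concentrated on smaller values. *)
Lemma depth_sum_dominates (f : nat -> rat) :
    (forall i j, (i <= j)%N -> f j <= f i) ->
  \sum_(u in B) f (t u) <= depth_sum s f.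
Proof.
move=> anti; have [|b [bs cs ss ls]] := almost_equal_count aes; first by rewrite sz.
(* Values are taken relative to the minimum [b] of [s]: below [b] the layers of [s] are full, its
   layer [b] contributes zero, and what [t] sends to [b] or beyond contributes at most zero. *)
have -> : \sum_(u in B) f (t u) = \sum_(u in B) (f (t u) - f b) + #|B|%:R * f b.
  by rewrite sumrB sumr_const mulr_natl subrK.
have -> : depth_sum s f = \sum_(i < b) m%:R * (f i - f b) + #|B|%:R * f b.
  rewrite -mulr_sumr -sm sumnE natr_sum mulr_suml.
  rewrite sum_const_size -big_split /=.
  apply: eq_big_seq => x xs; rewrite sumrB sumr_const card_ord mulr_natl.
  case: (bs x xs) => ->; first by rewrite subrK.
  by rewrite big_ord_recr /= mulrSr addrA subrK.
rewrite lerD2r.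
apply: (@le_trans _ _ (\sum_(u in B | (t u < b)%N) (f (t u) - f b))).
  rewrite [leLHS](bigID (fun u => (t u < b)%N)) /= gerDl.
  by apply: sumr_le0 => u /andP[_]; rewrite -leqNgt => h; rewrite subr_le0 anti.
case: (posnP b) => b0.
  by rewrite b0 big_ord0 big_pred0 // => u; rewrite ltn0 andbF.
rewrite (partition_big (fun u => insubd (Ordinal b0) (t u)) xpredT) //=.
apply: ler_sum => i _.
rewrite (eq_bigr (fun=> f i - f b)); last first.
  move=> u /andP[/andP[_ ub] /eqP <-]; congr (f _ - _).
  by rewrite val_insubd ub.
rewrite sumr_const -[X in X <= _]mulr_natl ler_wpM2r //.
  by rewrite subr_ge0 anti // ltnW.
rewrite ler_nat; apply: leq_trans (fiber i); apply: subset_leq_card.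
apply/subsetP => u; rewrite unfold_in inE => /andP[/andP[-> ub] /eqP <-].
by rewrite val_insubd ub eqxx.
Qed.

Lemma depth_sum_ge1 : 1 <= depth_sum s (fun b => phi b.+1).
Proof.
rewrite /depth_sum; move: m0 sz s1; case: (s) => [h0 h|x r _ _ /andP[]].
  by rewrite -h in h0.
case: x => [//|x] _ _.
rewrite big_cons big_ord_recl phi1 -addrA lerDl addr_ge0 //.
  by apply: sumr_ge0 => i _; apply: phi_ge0.
by apply: sumr_ge0 => y _; apply: sumr_ge0 => i _; apply: phi_ge0.
Qed.

(** Since [phi 0 = 0], [phi] is not monotone; composing with [maxn 1] repairs this, and the cost at
    depth 0 is recorded here. *)
Lemma depth_sum_maxn (f : nat -> rat) :
  depth_sum s (fun b => f b) = depth_sum s (fun b => f (maxn 1 b)) + m%:R * (f 0%N - f 1%N).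
Proof.
rewrite sum_const_size -big_split /=; apply: eq_big_seq => x xs.
have: (0 < x)%N by move/allP/(_ x xs): s1.
case: x {xs} => [//|x] _; rewrite !big_ord_recl /= (_ : maxn 1 0 = 1%N) //.
rewrite [X in _ = _ + X + _](eq_bigr (fun i : 'I_x => f (bump 0 i))); first by ring.
by move=> i _; congr f; rewrite /bump /=; lia.
Qed.

Local Notation q := #|[set u in B | t u == 0%N]|.

Lemma sum_maxn (f : nat -> rat) : \sum_(u in B) f (maxn 1 (t u)) =
  \sum_(u in B | t u != 0%N) f (t u) + q%:R * f 1%N.
Proof.
rewrite (bigID (fun u => t u != 0%N)) /=; congr (_ + _).
  by apply: eq_bigr => u /andP[_ u0]; congr f; lia.
rewrite (eq_bigr (fun=> f 1%N)); last first.
  by move=> u /andP[_]; rewrite negbK => /eqP ->.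
rewrite sumr_const mulr_natl; congr (_ *+ _).
by apply: eq_card => u; rewrite inE unfold_in negbK.
Qed.

Lemma q_le : (q <= m)%N. Proof. exact: fiber. Qed.

Lemma stem_part_le a (e : nat -> nat) (j : nat) : (j <= a)%N ->
    (e j <= (j < a) + (if j == 0 then q else 1))%N ->
  (e j)%:R * \sum_(u in B) phi (j + (t u).+1) <=
  (path_degree m.+1 a.+1 j)%:R * depth_sum s (fun b => phi (j + b.+1)).
Proof.
move=> ja ej; apply: ler_pM; rewrite ?ler0n ?ler_nat //.
- by apply: sumr_ge0 => u _; apply: phi_ge0.
- by apply: leq_trans ej _; rewrite /path_degree; have := q_le; case: eqP => _; lia.
by apply: depth_sum_dominates => i k ik; apply: phi_le; lia.
Qed.

(** Strictness comes from the degree of the stem vertex j = 0, which has at most [q] instead of [m]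
    neighbours outside the stem. *)
Lemma stem_part_lt a (e : nat -> nat) : (q < m)%N ->
    (e 0%N <= (0 < a) + q)%N ->
  (e 0%N)%:R * \sum_(u in B) phi (0 + (t u).+1) <
  (path_degree m.+1 a.+1 0)%:R * depth_sum s (fun b => phi (0 + b.+1)).
Proof.
move=> qm e0.
have h : \sum_(u in B) phi (0 + (t u).+1) <= depth_sum s (fun b => phi (0 + b.+1)).
  by apply: depth_sum_dominates => i k ik; apply: phi_le; lia.
apply: (@le_lt_trans _ _ ((e 0%N)%:R * depth_sum s (fun b => phi (0 + b.+1)))).
  by rewrite ler_wpM2l ?ler0n.
rewrite ltr_pM2r; last by apply: lt_le_trans depth_sum_ge1.
by rewrite ltr_nat; apply: leq_ltn_trans e0 _; rewrite /path_degree /= muln1; lia.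
Qed.

(** After comparison through [maxn 1], the sum of [phi] exceeds that of [s] by at most m - q. The
    factor m - 1 in place of q - 1 wins at least m - q back, by [depth_sum_ge1]. *)
Lemma clique_part_le : (0 < q)%N ->
  \sum_(u in B) (phi (t u) + (q.-1)%:R * phi (t u).+1) <=
  depth_sum s phi + (m.-1)%:R * depth_sum s (fun b => phi b.+1).
Proof.
move=> q0; rewrite big_split /= -mulr_sumr.
have anti i j : (i <= j)%N -> phi j.+1 <= phi i.+1 by move=> ij; apply: phi_le.
have h1 := depth_sum_dominates anti.
have h2 : \sum_(u in B) phi (maxn 1 (t u)) <= depth_sum s (fun b => phi (maxn 1 b)).
  by apply: (@depth_sum_dominates (fun b => phi (maxn 1 b))) => i j ij; apply: phi_le; lia.
have h3 : \sum_(u in B) phi (t u) = \sum_(u in B | t u != 0%N) phi (t u).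
  rewrite (bigID (fun u => t u != 0%N)) /= [X in _ + X]big1 ?addr0 //.
  by move=> u /andP[_]; rewrite negbK => /eqP ->; rewrite phi0.
have h4 := depth_sum_maxn phi; have h5 := depth_sum_ge1.
rewrite sum_maxn phi1 in h2; rewrite phi0 phi1 in h4.
have eq_q : q%:R = (q.-1)%:R + 1 :> rat by rewrite natr1 prednK.
have eq_m : m%:R = (m.-1)%:R + 1 :> rat by rewrite natr1 prednK.
have qm : (q.-1)%:R <= (m.-1)%:R :> rat by rewrite ler_nat; have := q_le; lia.
have q0' : 0 <= (q.-1)%:R :> rat by rewrite ler0n.
rewrite eq_q in h2; rewrite eq_m in h4.
rewrite h3; move: h1 h2 h4 h5 qm q0'.
move: (depth_sum s (fun b => phi (maxn 1 b))) (depth_sum s phi) (depth_sum s _).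
move: (q.-1)%:R (m.-1)%:R => c1 c2 D1 D2 D3.
nra.
Qed.

Variables d sib child : T -> nat.
Hypothesis m1 : (1 < m)%N.
Hypothesis d_le : forall u, u \in B -> (d u <= 1 + sib u + child u)%N.
Hypothesis sib_le : (\sum_(u in B) sib u + (m - q) <= m * m.-1)%N.
Hypothesis child_le : forall f : nat -> rat, (forall i, 0 <= f i) ->
  \sum_(u in B) (child u)%:R * f (t u).+1 <= \sum_(u in B | t u != 0%N) f (t u).

(** Degrees split into parent, siblings and children. Siblings are estimated with [f 1], and their
    deficit m - q offsets exactly the [q] instead of [m] copies of [f 1] in [sum_maxn]. *)
Lemma degree_part_le (f : nat -> rat) : (forall i, 0 <= f i) ->
    (forall i j, (0 < i)%N -> (i <= j)%N -> f j <= f i) ->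
  \sum_(u in B) (d u)%:R * f (t u).+1 <=
  \sum_(y <- s) \sum_(b < y) (path_degree m.+1 y b)%:R * f b.+1.
Proof.
move=> f0 anti; rewrite depth_sum_path_degree //.
apply: (@le_trans _ _ (\sum_(u in B) f (t u).+1 +
    \sum_(u in B) (sib u)%:R * f (t u).+1 + \sum_(u in B) (child u)%:R * f (t u).+1)).
  rewrite -!big_split; apply: ler_sum => u uB /=.
  rewrite -[X in X + _ + _]mul1r -!mulrDl ler_wpM2r //.
  by rewrite -[1]/(1%:R) -!natrD ler_nat d_le.
have h1 : \sum_(u in B) f (t u).+1 <= depth_sum s (fun b => f b.+1).
  by apply: depth_sum_dominates => i j ij; apply: anti.
have h2 : \sum_(u in B) f (maxn 1 (t u)) <= depth_sum s (fun b => f (maxn 1 b)).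
  apply: (@depth_sum_dominates (fun b => f (maxn 1 b))) => i j ij; apply: anti; lia.
have h3 := child_le f0; rewrite sum_maxn in h2.
have h4 : \sum_(u in B) (sib u)%:R * f (t u).+1 <=
    ((m * m.-1)%:R - (m%:R - q%:R)) * f 1%N.
  apply: (@le_trans _ _ (\sum_(u in B) (sib u)%:R * f 1%N)).
    by apply: ler_sum => u _; rewrite ler_wpM2l ?ler0n // anti.
  rewrite -mulr_suml ler_wpM2r // -natr_sum -natrB ?q_le // -natrB ?ler_nat.
    by have := sib_le; lia.
  by apply: leq_trans sib_le; apply: leq_addl.
move: h1 h2 h3 h4; lra.
Qed.

End Dominate.

Lemma shift_phi_ge0 x e : 0 <= shift_phi x e.
Proof. by apply: sumr_ge0 => j _; apply: phi_ge0. Qed.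

Lemma shift_phi_le x e f : (0 < e)%N -> (e <= f)%N -> shift_phi x f <= shift_phi x e.
Proof. by move=> e0 ef; apply: ler_sum => j _; apply: phi_le; lia. Qed.

(** * The blocks of RDD formed by the stem and the rest *)

Section Compare.
Variable G : sgraph.
Hypothesis cG : connected G.
Hypothesis satG : saturated G.
Variable w : G.
Implicit Types x y z c u v p : G.
Local Notation s := (distance w).
Local Notation anc v x := (between v w x).
Hypothesis ncw : ~~ cut_vertex w.
Variable a : nat.
Hypothesis stem_layer : forall i, (i <= a)%N -> #|layer w i| = 1%N.
Hypothesis branching : (1 < #|layer w a.+1|)%N.
Local Notation q := #|layer w a.+1|.
Local Notation B := (rest w a).
Local Notation G0 := (induced B).
Local Notation m := #|ends w|.
Local Notation t := (fun u => (s u - a.+1)%N).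

(** The stem is indexed from the clique: a - s x runs from 0 next to the branching layer to [a] at
    [w], each value taken once. *)
Lemma stem_sum (g : nat -> rat) :
  \sum_(x | x \notin B) g (a - s x)%N = \sum_(j < a.+1) g j.
Proof.
rewrite (partition_big (fun x => inord (a - s x) : 'I_a.+1) xpredT) //=.
apply: eq_bigr => j _.
have [x sx] := stem_exists stem_layer (leq_subr j a).
have ja := ltn_ord j; rewrite ltnS in ja.
rewrite (bigD1 x) /=; last by rewrite inE sx -leqNgt leq_subr subKn //= inord_val.
rewrite sx subKn // big1 ?addr0 // => y /andP[/andP[yB /eqP yj]].
rewrite inE -leqNgt in yB; case/eqP; apply: (stem_single stem_layer yB).
by rewrite sx -yj inordK ?subKn // ltnS leq_subr.
Qed.

Lemma distance_stem x y : x \notin B -> distance x y =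
  if y \in B then ((a - s x) + (t y).+1)%N else ((a - s x) - (a - s y) + ((a - s y) - (a - s x)))%N.
Proof.
rewrite !inE -leqNgt => xa; case: ltnP => ya.
  have : anc x y by apply: (stem_anc cG stem_layer) => //; lia.
  by rewrite /between => /eqP; lia.
case: (leqP (s x) (s y)) => xy.
  have : anc x y by apply: (stem_anc cG stem_layer) => //; lia.
  by rewrite /between => /eqP; lia.
have : anc y x by apply: (stem_anc cG stem_layer) => //; lia.
by rewrite /between (distance_sym cG x) => /eqP; lia.
Qed.

(** [top u] is at distance [t u]; any other vertex of its layer is no ancestor of [u], hence at
    distance at least one more. *)
Lemma sum_layer_phi u : u \in B ->
  \sum_(z in layer w a.+1) phi (distance z u) <= phi (t u) + (q.-1)%:R * phi (t u).+1.
Proof.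
rewrite inE => au; have [tl tu] := topP cG au.
rewrite (bigD1 (top w a u)) //=; apply: lerD.
  move: tl tu; rewrite inE /between => /eqP -> /eqP h.
  by rewrite h addKn.
rewrite (eq_bigl (mem (layer w a.+1 :\ top w a u))); last first.
  by move=> z; rewrite !inE andbC.
apply: (@le_trans _ _ (\sum_(z in layer w a.+1 :\ top w a u) phi (t u).+1)); last first.
  by rewrite (cardsD1 (top w a u) (layer _ _)) tl sumr_const mulr_natl.
apply: ler_sum => z /setD1P[zt zl]; apply: phi_le => //.
have tri := distance_triangle cG w z u; have zl' := zl.
move: zl'; rewrite inE => /eqP sz.
have ne : s u != (s z + distance z u)%N.
  by apply: contra zt => h; rewrite (top_uniq cG satG zl h).
lia.
Qed.

Lemma rest_part_le : \sum_(x in B) \sum_(y in B) (degree x)%:R * phi (distance x y) <=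
  RDD G0 + \sum_(u in B) (phi (t u) + (q.-1)%:R * phi (t u).+1).
Proof.
rewrite (RDD_sum (connected_rest cG satG ncw stem_layer branching)).
apply: (@le_trans _ _ (\sum_(x : G0) \sum_(y : G0) (degree x)%:R * phi (distance x y) +
   \sum_(x in B) \sum_(y in B) (x \in layer w a.+1)%:R * phi (distance x y))).
  rewrite !(big_sub B) -big_split /=; apply: ler_sum => x _.
  rewrite !(big_sub B) -big_split /=; apply: ler_sum => y _.
  rewrite (distance_rest cG satG ncw stem_layer branching) -mulrDl ler_wpM2r ?phi_ge0 //.
  by rewrite -natrD ler_nat (degree_rest cG satG ncw stem_layer branching).
rewrite lerD2l exchange_big /=; apply: ler_sum => u uB.
apply: le_trans (sum_layer_phi uB).
rewrite (bigID (mem (layer w a.+1))) /= [X in _ + X]big1 ?addr0; last first.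
  by move=> z /andP[_ /negPf->]; rewrite mul0r.
rewrite (eq_bigl (mem (layer w a.+1))); last first.
  by move=> z; rewrite /= andb_idl // => /layer_rest.
by apply: ler_sum => z /= ->; rewrite mul1r.
Qed.

Lemma degree_stem_le x : x \notin B ->
  (degree x <= ((a - s x < a) + (if (a - s x == 0)%N then q else 1)))%N.
Proof.
rewrite inE -leqNgt => xa; apply: leq_trans (stem_degree cG satG stem_layer branching xa) _.
by apply: leq_add; [lia | case: eqP => h1; case: eqP => h2 //; lia].
Qed.

Lemma q_le_ends : (q <= m)%N. Proof. exact: (card_layer cG w satG (ltn0Sn a)). Qed.

Lemma inner_part_le :
  \sum_(x | x \notin B) \sum_(y | y \notin B) (degree x)%:R * phi (distance x y) <=
  inner_sum m.+1 a.+1.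
Proof.
rewrite /inner_sum -(stem_sum (fun i => \sum_(b < a.+1) (path_degree m.+1 a.+1 i)%:R *
   phi (i - b + (b - i)))).
apply: ler_sum => x xB.
rewrite -(stem_sum (fun b => (path_degree m.+1 a.+1 (a - s x))%:R * phi (a - s x - b + (b - (a - s x))))).
apply: ler_sum => y yB; rewrite distance_stem // (negPf yB) ler_wpM2r ?phi_ge0 // ler_nat.
apply: leq_trans (degree_stem_le xB) _; rewrite /path_degree.
by have := q_le_ends; case: eqP => _; lia.
Qed.

Variable r : seq nat.
Hypothesis sz : size r = m.
Hypothesis r1 : all (leq 1) r.
Hypothesis aer : almost_equal r.
Hypothesis sm : sumn r = #|B|.

Lemma rest_fiber0 : [set u in B | t u == 0%N] = layer w a.+1.
Proof. by apply/setP => u; rewrite !inE; lia. Qed.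

Lemma rest_fiber i : (#|[set u in B | t u == i]| <= m)%N.
Proof.
apply: leq_trans (card_layer cG w satG (ltn0Sn (a + i))).
apply: subset_leq_card; apply/subsetP => u; rewrite !inE; lia.
Qed.

Lemma sum_siblings : (\sum_(u in B) #|siblings w u| + (m - q) <= m * m.-1)%N.
Proof.
apply: leq_trans (card_sib_pairs cG satG stem_layer branching); rewrite leq_add2r.
rewrite -sum1_card; under eq_bigr do rewrite -sum1_card.
rewrite pair_big_dep /= leq_eqVlt; apply/orP; left; apply/eqP; apply: eq_bigl => -[u v] /=.
rewrite !inE /= [s v == _]eq_sym; case E: (edge u v) => /=; last by rewrite andbF.
by case: eqP => [e|]; rewrite ?andbF // andbT (edge_layer_gt stem_layer E e).
Qed.

(** After exchanging the sums, each vertex outside the first layer of the rest is counted for at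
    most one parent. *)
Lemma sum_children (f : nat -> rat) : (forall i, 0 <= f i) ->
  \sum_(u in B) (#|children w u|)%:R * f (t u).+1 <= \sum_(u in B | t u != 0%N) f (t u).
Proof.
move=> f0.
have -> : \sum_(u in B) (#|children w u|)%:R * f (t u).+1 =
    \sum_(u in B) \sum_(v | (v \in children w u) && ((v \in B) && (t v != 0%N))) f (t v).
  apply: eq_bigr => u; rewrite inE => ua; rewrite mulr_natl -sumr_const.
  rewrite (eq_bigl (fun v => (v \in children w u) && ((v \in B) && (t v != 0%N)))); last first.
    by move=> v; rewrite !inE; case: edge => //=; lia.
  apply: eq_bigr => v /andP[]; rewrite inE => /andP[_ /eqP ->] _; congr f; lia.
rewrite (exchange_big_dep (fun v => (v \in B) && (t v != 0%N))) /=; last first.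
  by move=> u v _ /andP[].
apply: ler_sum => v vB; rewrite sumr_const.
rewrite -[leRHS]mulr1n; apply: ler_wpMn2l => //.
apply: leq_trans (card_parents cG w satG v); apply: subset_leq_card.
by apply/subsetP => u; rewrite unfold_in inE => /andP[_ /andP[]].
Qed.

Lemma RDD_split : RDD G =
  \sum_(x in B) \sum_(y in B) (degree x)%:R * phi (distance x y) +
  \sum_(x | x \notin B) \sum_(y | y \notin B) (degree x)%:R * phi (distance x y) +
  (\sum_(x | x \notin B) \sum_(y in B) (degree x)%:R * phi (distance x y) +
   \sum_(y in B) (degree y)%:R * shift_phi a.+1 (t y).+1).
Proof.
rewrite (RDD_sum cG) (bigID (mem B)) /=.
have sp P : \sum_(x | P x) \sum_(y : G) (degree x)%:R * phi (distance x y) =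
    \sum_(x | P x) \sum_(y in B) (degree x)%:R * phi (distance x y) +
    \sum_(x | P x) \sum_(y | y \notin B) (degree x)%:R * phi (distance x y).
  by rewrite -big_split; apply: eq_bigr => x _; rewrite (bigID (mem B)).
rewrite !sp; have -> : \sum_(x in B) \sum_(y | y \notin B) (degree x)%:R * phi (distance x y) =
    \sum_(y in B) (degree y)%:R * shift_phi a.+1 (t y).+1.
  apply: eq_bigr => y yB; rewrite -mulr_sumr /shift_phi.
  rewrite -(stem_sum (fun j => phi (j + (t y).+1))); congr (_ * _).
  by apply: eq_bigr => x xB; rewrite (distance_sym cG) distance_stem // yB.
by ring.
Qed.

Lemma stem_rest_part :
  \sum_(x | x \notin B) \sum_(y in B) (degree x)%:R * phi (distance x y) <=
  \sum_(j < a.+1) ((j < a) + (if j == 0 :> nat then q else 1))%N%:R *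
     \sum_(u in B) phi (j + (t u).+1).
Proof.
rewrite -(stem_sum (fun j => ((j < a) + (if j == 0 :> nat then q else 1))%N%:R *
     \sum_(u in B) phi (j + (t u).+1))).
apply: ler_sum => x xB; rewrite mulr_sumr; apply: ler_sum => y yB.
by rewrite distance_stem // yB ler_wpM2r ?phi_ge0 // ler_nat degree_stem_le.
Qed.

(** The blocks of [RDD_split] are bounded one by one by the terms of [paths_RDD_extend]; for q < m
    the summand j = 0 of the stem is strict. *)
Lemma RDD_compare :
  RDD G <= RDD G0 + (paths_RDD m.+1 (a.+1 :: r) - paths_RDD m r) /\
  ((q < m)%N -> RDD G < RDD G0 + (paths_RDD m.+1 (a.+1 :: r) - paths_RDD m r)).
Proof.
have m1 : (1 < m)%N by apply: leq_trans branching q_le_ends.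
have m0 := ltnW m1.
rewrite paths_RDD_extend // RDD_split.
have h1 := rest_part_le; have h2 := inner_part_le.
have q0 : (0 < #|[set u in B | t u == 0%N]|)%N by rewrite rest_fiber0 ltnW.
have sl : (\sum_(u in B) #|siblings w u| + (m - #|[set u in B | t u == 0%N]|) <= m * m.-1)%N.
  by rewrite rest_fiber0 sum_siblings.
have h3 := degree_part_le sz r1 aer m0 sm rest_fiber m1
  (fun u _ => degree_siblings_children cG w satG u) sl sum_children (@shift_phi_ge0 a.+1)
  (@shift_phi_le a.+1).
have h4 := clique_part_le sz r1 aer m0 sm rest_fiber q0.
rewrite rest_fiber0 in h4.
have h5 := stem_rest_part.
have qe : #|[set u in B | t u == 0%N]| = q by rewrite rest_fiber0.
pose e (j : nat) := ((j < a) + (if j == 0%N then q else 1))%N.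
have he j : (e j <= (j < a) + (if j == 0%N then #|[set u in B | t u == 0%N]| else 1))%N.
  by rewrite qe.
have h6 (j : 'I_a.+1) : (e j)%:R * \sum_(u in B) phi (j + (t u).+1) <=
    (path_degree m.+1 a.+1 j)%:R * depth_sum r (fun b => phi (j + b.+1)).
  have ja : (j <= a)%N by rewrite -ltnS ltn_ord.
  exact: (stem_part_le sz r1 aer m0 sm rest_fiber ja (he j)).
have h7 : \sum_(j < a.+1) (e j)%:R * \sum_(u in B) phi (j + (t u).+1) <=
    \sum_(j < a.+1) (path_degree m.+1 a.+1 j)%:R * depth_sum r (fun b => phi (j + b.+1)).
  by apply: ler_sum => j _; apply: h6.
have h8 : (q < m)%N -> \sum_(j < a.+1) (e j)%:R * \sum_(u in B) phi (j + (t u).+1) <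
    \sum_(j < a.+1) (path_degree m.+1 a.+1 j)%:R * depth_sum r (fun b => phi (j + b.+1)).
  move=> qm; rewrite big_ord_recl [ltRHS]big_ord_recl; apply: ltr_leD.
    apply: (stem_part_lt sz r1 aer m0 sm rest_fiber (a := a) (e := e)); rewrite qe //.
  by apply: ler_sum => j _; apply: h6.
rewrite /e /= in h7 h8.
by split=> [|/h8 h9]; [move: h1 h2 h3 h4 h5 h7|move: h1 h2 h3 h4 h5 h9]; lra.
Qed.

End Compare.

(** * The case of equality *)

Local Close Scope ring_scope.

Lemma isomorphic_trans (G H K : sgraph) :
  isomorphic G H -> isomorphic H K -> isomorphic G K.
Proof.
move=> [f bf ef] [g bg eg]; exists (g \o f); first exact: bij_comp.
by move=> x y; rewrite /= eg ef.
Qed.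

Lemma isomorphic_RDD (G H : sgraph) : connected G -> isomorphic G H ->
  RDD G = RDD H.
Proof.
move=> cG [f [g fK gK] ef].
have eg x y : edge (g x) (g y) = edge x y by rewrite -ef !gK.
have cH : connected H.
  move=> x y; rewrite -(gK x) -(gK y).
  apply: (proj1 (@distance_retract G H f cG _ (g x) (g y))) => u v e.
  by right; rewrite ef.
have dE x y : distance (f x) (f y) = distance x y.
  apply/eqP; rewrite eqn_leq; apply/andP; split.
    apply: (proj2 (@distance_retract G H f cG _ x y)) => u v e.
    by right; rewrite ef.
  rewrite -{1}(fK x) -{1}(fK y).
  apply: (proj2 (@distance_retract H G g cH _ (f x) (f y))) => u v e.
  by right; rewrite eg.
have degE x : degree (f x) = degree x.
  rewrite /degree -(card_imset _ (can_inj fK)); apply: eq_card => y.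
  apply/idP/imsetP; first by rewrite inE => e; exists (g y); rewrite ?gK // inE -ef gK.
  by move=> [z]; rewrite inE => e ->; rewrite inE ef.
rewrite (RDD_sum cG) (RDD_sum cH) [RHS](reindex f); last by exists g => x _.
apply: eq_bigr => x _; rewrite [RHS](reindex f); last by exists g => y _.
by apply: eq_bigr => y _; rewrite degE dE.
Qed.

Lemma card_clique_paths m (l : 'I_m -> nat) :
  #|clique_paths l| = sumn [seq (l i).+1 | i <- enum 'I_m].
Proof.
by rewrite /= card_tagged; congr sumn; apply: eq_map => i; rewrite card_ord.
Qed.

Lemma clique_paths_perm m (l l' : 'I_m -> nat) :
    perm_eq [seq (l i).+1 | i <- enum 'I_m] [seq (l' i).+1 | i <- enum 'I_m] ->
  isomorphic (clique_paths l) (clique_paths l').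
Proof.
move=> pe; have cardE : #|clique_paths l| = #|clique_paths l'|.
  by rewrite !card_clique_paths; apply: perm_sumn.
have /tuple_permP[p pE] : perm_eq [tuple (l i).+1 | i < m] [tuple (l' i).+1 | i < m].
  by [].
have lE i : l i = l' (p i).
  have := congr1 (fun s => nth 0 s i) pE; rewrite -tnth_nth tnth_mktuple.
  by rewrite -tnth_nth !tnth_mktuple => -[].
pose f (u : clique_paths l) : clique_paths l' :=
  @Tagged _ (p (tag u)) (fun i => 'I_(l' i).+1) (inord (depth u)).
have df u : depth (f u) = depth u.
  by rewrite {1}/depth /f /= inordK // -lE; apply: ltn_ord.
have fi : injective f.
  move=> u v e; apply: clique_paths_inj; last by rewrite -!df e.
  by apply: (@perm_inj _ p); have := congr1 (fun x => tag x) e.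
exists f; first by apply: inj_card_bij; rewrite ?cardE.
by move=> u v; rewrite !edge_clique_paths !df /f /= (inj_eq perm_inj).
Qed.

(** Here [root u] stands for the clique vertex of the path through [u], and [dep u] for the position
    of [u] on that path. *)
Lemma clique_paths_criterion (G : sgraph) (K : {set G}) (root : G -> G) (dep : G -> nat) :
    0 < #|K| ->
    (forall u, root u \in K) -> (forall z, z \in K -> root z = z) ->
    (forall u v, root u = root v -> dep u = dep v -> u = v) ->
    (forall u j, j <= dep u -> exists2 v, root v = root u & dep v = j) ->
    (forall u v, edge u v = if root u == root v
       then ((dep u).+1 == dep v) || ((dep v).+1 == dep u)
       else (dep u == 0) && (dep v == 0)) ->
  exists l : 'I_#|K| -> nat, isomorphic G (clique_paths l).
Proof.
move=> K0 rK rid inj down edgeE; have [z0 z0K] := card_gt0P K0.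
pose idx u := enum_rank_in z0K (root u).
have idx_inj u v : idx u = idx v -> root u = root v.
  by move/enum_rank_in_inj; apply.
pose l i := \max_(u | idx u == i) dep u; exists l.
have dl u : dep u <= l (idx u) by apply: (@leq_bigmax_cond _ _ (fun u => dep u)).
pose f u : clique_paths l := @Tagged _ (idx u) (fun i => 'I_(l i).+1) (inord (dep u)).
have df u : depth (f u) = dep u by rewrite /depth /f /= inordK ?ltnS.
have fi : injective f.
  move=> u v e; apply: inj; last by rewrite -!df e.
  by apply: idx_inj; have := congr1 (fun x => tag x) e.
exists f; last first.
  move=> u v; rewrite edge_clique_paths !df /f /= edgeE; congr (if _ then _ else _).
  by apply/eqP/eqP => [/idx_inj|e] //; rewrite /idx e.
apply: inj_card_bij => //.
have surj y : exists x, f x = y.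
  have [u iu du] : exists2 u, idx u = tag y & dep u = l (tag y).
    have ne : 0 < #|[pred u | idx u == tag y]|.
      apply/card_gt0P; exists (enum_val (tag y)); rewrite inE /idx rid ?enum_valP //.
      by rewrite enum_valK_in.
    by have [u /eqP iu du] := eq_bigmax_cond dep ne; exists u.
  have hy : depth y <= dep u by rewrite du -ltnS; apply: ltn_ord.
  have [v rv dv] := down u (depth y) hy; exists v.
  apply: clique_paths_inj; last by rewrite df.
  by rewrite /f /= -iu /idx rv.
have -> : #|clique_paths l| = #|[set f x | x in G]|.
  rewrite -cardsT; apply: eq_card => y; rewrite inE; apply/esym/imsetP.
  by have [x <-] := surj y; exists x.
exact: leq_imset_card.
Qed.

Section FullClique.
Variable G : sgraph.
Hypothesis cG : connected G.
Hypothesis satG : saturated G.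
Variable w : G.
Implicit Types x y z c u v p : G.
Local Notation s := (distance w).
Local Notation anc v x := (between v w x).
Hypothesis ncw : ~~ cut_vertex w.
Variable a : nat.
Hypothesis stem_layer : forall i, i <= a -> #|layer w i| = 1.
Hypothesis branching : 1 < #|layer w a.+1|.
Hypothesis full : #|layer w a.+1| = #|ends w|.
Local Notation top := (top w a).

(** Otherwise [u], [v] and the vertices of layer a + 1 other than their common top would form an
    antichain with one element more than there are ends. *)
Lemma top_layer_inj u v : a < s u -> top u = top v -> s u = s v -> u = v.
Proof.
move=> au tuv suv; apply/eqP/negPn/negP => uv.
have av : a < s v by rewrite -suv.
pose Q' := layer w a.+1 :\ top u.
have topQ x : x \in layer w a.+1 -> top x = x.
  by move=> xl; apply: (top_uniq cG satG xl); apply: anc_refl.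
have la x : x \in layer w a.+1 -> a < s x by rewrite inE => /eqP ->.
have topu := topP cG au; have uQ : u \notin Q'.
  by apply/setD1P => -[h /topQ e]; rewrite e eqxx in h.
have vQ : v \notin Q'.
  by apply/setD1P => -[h /topQ e]; rewrite tuv e eqxx in h.
have card : #|u |: (v |: Q')| = #|ends w|.+1.
  have uvQ : u \notin v |: Q' by rewrite in_setU1 negb_or uv uQ.
  by rewrite !cardsU1 uvQ vQ -full (cardsD1 (top u) (layer _ _)) topu.1.
suff : #|u |: (v |: Q')| <= #|ends w| by rewrite card ltnn.
have aU x : x \in u |: (v |: Q') -> a < s x.
  by move/setU1P => [->|/setU1P[->|/setD1P[_ /la]]].
apply: card_antichain => //.
  by apply/negP => /aU; rewrite distance_xx.
move=> x y z xU yU xz yz; have txy : top x = top y.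
  by rewrite -(top_anc cG satG (aU x xU) xz) (top_anc cG satG (aU y yU) yz).
have sxy : s x = s y -> x = y by apply: anc_uniq xz yz.
case/setU1P: xU => [xE|/setU1P[xE|/setD1P[xt xl]]];
  case/setU1P: yU => [yE|/setU1P[yE|/setD1P[yt yl]]]; subst; try by apply: sxy.
- by rewrite txy (topQ _ yl) eqxx in yt.
- by rewrite tuv txy (topQ _ yl) eqxx in yt.
- by rewrite -txy (topQ _ xl) eqxx in xt.
- by rewrite tuv -txy (topQ _ xl) eqxx in xt.
- by apply: sxy; move: xl yl; rewrite !inE => /eqP -> /eqP ->.
Qed.

(** The clique is layer a + 1 together with the last stem vertex [p], whose attached path is the
    stem; by [top_layer_inj] every other branch is a path. *)
Lemma full_clique_iso :
  exists l : 'I_#|ends w|.+1 -> nat, isomorphic G (clique_paths l).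
Proof.
have [p sp] := stem_exists stem_layer (leqnn a).
have pQ : p \notin layer w a.+1 by rewrite inE sp; lia.
have cardK : #|p |: layer w a.+1| = #|ends w|.+1 by rewrite cardsU1 pQ full.
pose root u := if a < s u then top u else p.
pose dep u := if a < s u then s u - a.+1 else a - s u.
rewrite -cardK; apply: (@clique_paths_criterion G _ root dep).
- by rewrite cardK.
- move=> u; rewrite /root; case: ltnP => h; rewrite !inE ?eqxx //.
  by have [] := topP cG h; rewrite inE => ->; rewrite orbT.
- move=> z /setU1P[->|zl]; rewrite /root; first by rewrite sp ltnn.
  have -> : a < s z by move: zl; rewrite inE => /eqP ->.
  by apply: (top_uniq cG satG zl); apply: anc_refl.
- move=> u v; rewrite /root /dep.
  have tp x : a < s x -> top x <> p.
    by move=> h e; have [] := topP cG h; rewrite e (negPf pQ).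
  case: ltnP => hu; case: ltnP => hv.
  + by move=> tuv d; apply: top_layer_inj => //; lia.
  + by move=> /tp; case.
  + by move=> /esym/tp; case.
  + by move=> _ d; apply: (stem_single stem_layer hu); lia.
- move=> u j; rewrite /root /dep; case: ltnP => hu hj.
    have [v sv vu] : exists2 v, s v = a.+1 + j & anc v u by apply: anc_exists => //; lia.
    have va : a < s v by lia.
    exists v; rewrite va; last by lia.
    by rewrite (top_anc cG satG va vu).
  have [v sv] := stem_exists stem_layer (leq_subr j a).
  have nv : (a < s v) = false by lia.
  by exists v; rewrite nv //; lia.
have stemE u v : s u <= a -> s v <= a -> edge u v = (((s u).+1 == s v) || ((s v).+1 == s u)).
  wlog le : u v / s u <= s v => [hw|] hu hv.
    have /orP[h|h] := leq_total (s u) (s v); first exact: hw.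
    by rewrite edge_sym orbC hw.
  have /eqP uv := stem_anc cG stem_layer hu le.
  apply/idP/idP => [e|h]; first by move: uv; rewrite (distance_edge cG e); lia.
  by apply: (distance1_edge cG); lia.
have mixE u v : s u <= a -> a < s v -> edge u v = ((s u == a) && (s v == a.+1)).
  move=> hu hv; have le : s u <= s v by lia.
  have /eqP uv := stem_anc cG stem_layer hu le.
  apply/idP/idP => [e|h]; first by move: uv; rewrite (distance_edge cG e); lia.
  by apply: (distance1_edge cG); lia.
move=> u v; rewrite /root /dep.
have tp x : a < s x -> top x == p = false.
  by move=> h; apply/eqP => e; have [] := topP cG h; rewrite e (negPf pQ).
case: ltnP => hu; case: ltnP => hv; last 3 first.
- by rewrite edge_sym (mixE v u) // (tp u hu); lia.
- by rewrite mixE // [p == _]eq_sym (tp v hv); lia.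
- by rewrite stemE // eqxx; lia.
have [tul tuu] := topP cG hu; have [tvl tvv] := topP cG hv.
apply/idP/idP => [e|].
  wlog le : u v hu hv tul tuu tvl tvv e / s u <= s v => [hw|].
    have /orP[h|h] := leq_total (s u) (s v); first exact: hw.
    rewrite eq_sym orbC andbC; apply: hw => //; by rewrite edge_sym.
  have [svu|svu|h] := layer_edge cG w e; last by rewrite h ltnn in le.
    have [x sx [xu xv]] := sibling_parent cG satG e (esym svu).
    case: (ltngtP (s u) a.+1) => h; first by rewrite ltnS leqNgt hu in h.
      have ax : a < s x by rewrite -ltnS -sx.
      have tuv : top u = top v.
        by rewrite (top_anc cG satG ax xu) (top_anc cG satG ax xv).
      by have := edge_neq e; rewrite (top_layer_inj hu tuv (esym svu)) eqxx.
    have tu : top u = u by apply: (top_uniq cG satG); rewrite ?inE ?h ?anc_refl.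
    have tv : top v = v by apply: (top_uniq cG satG); rewrite ?inE ?svu ?h ?anc_refl.
    by rewrite tu tv (negPf (edge_neq e)) svu h subnn.
  have uv := edge_anc cG e svu.
  by rewrite (top_anc cG satG hu uv) eqxx svu subSn ?eqxx.
case: eqP => [tuv|tuv].
  wlog le : u v hu hv tul tuu tvl tvv tuv / s u <= s v => [hw|].
    have /orP[h|h] := leq_total (s u) (s v); first exact: hw.
    by rewrite edge_sym orbC; apply: hw => //.
  move=> h; have svu : s v = (s u).+1 by lia.
  have [x ex sx] := distance_pred cG svu.
  have ax : a < s x by rewrite sx.
  have xv := edge_anc cG ex (etrans svu (congr1 S (esym sx))).
  have txu : top x = top u by rewrite tuv (top_anc cG satG ax xv).
  by rewrite -(top_layer_inj ax txu sx).
move=> /andP[/eqP du /eqP dv].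
have ul : u \in layer w a.+1 by rewrite inE; lia.
have vl : v \in layer w a.+1 by rewrite inE; lia.
apply: (layer_clique cG satG stem_layer) => //.
by apply/eqP => uv; apply: tuv; rewrite uv.
Qed.

End FullClique.

Lemma path_like_iso (G H : sgraph) (f : G -> nat) (g : H -> nat) :
    #|G| = #|H| -> injective f -> injective g ->
    (forall x, f x < #|G|) -> (forall x, g x < #|H|) ->
    (forall x y, edge x y = ((f x).+1 == f y) || ((f y).+1 == f x)) ->
    (forall x y, edge x y = ((g x).+1 == g y) || ((g y).+1 == g x)) ->
  isomorphic G H.
Proof.
move=> cardE fi gi fl gl ef eg.
pose g' y : 'I_#|H| := Ordinal (gl y).
have g'i : injective g' by move=> x y [/gi].
have [h g'K hK] : bijective g' by apply: inj_card_bij; rewrite ?card_ord.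
have fl' x : f x < #|H| by rewrite -cardE.
pose k x := h (Ordinal (fl' x)).
have gk x : g (k x) = f x by have := congr1 val (hK (Ordinal (fl' x))).
exists k; last by move=> x y; rewrite eg ef !gk.
apply: inj_card_bij; last by rewrite cardE.
by move=> x y e; apply: fi; rewrite -!gk e.
Qed.

Lemma distance_lt_card (G : sgraph) (cG : connected G) (x y : G) : distance x y < #|G|.
Proof.
rewrite -[X in X <= _](size_iota 0) cardE -(size_map (distance x)).
apply: uniq_leq_size; first exact: iota_uniq.
move=> i; rewrite mem_iota /= add0n ltnS => /(distance_point cG)[z <- _].
by apply: map_f; rewrite mem_enum.
Qed.

(** Every layer around [w] has at most one vertex, so the distance from [w] numbers the vertices of
    a path. *)
Lemma two_ends_iso (G : sgraph) (w : G) (m : nat) (l : 'I_m -> nat) :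
    connected G -> saturated G -> #|ends w| = 1 -> m = 2 ->
  #|G| = #|clique_paths l| -> isomorphic G (clique_paths l).
Proof.
move=> cG satG e1 m2; subst m => cardE.
have inj : injective (distance w).
  move=> x y dxy; case: (posnP (distance w x)) => [d0|d0].
    move: (d0) (d0); rewrite {2}dxy => /eqP; rewrite distance_eq0 // => /eqP <- /eqP.
    by rewrite distance_eq0 // => /eqP.
  have := card_layer cG w satG d0; rewrite e1 => /card_le1_eqP/(_ y x).
  by apply; rewrite inE ?dxy.
(* The two attached paths are read as one: the first from its far end to the clique, then the second
   outwards. *)
pose g (u : clique_paths l) :=
  if tag u == ord0 then l ord0 - depth u else (l ord0).+1 + depth u.
have dl (u : clique_paths l) : depth u <= l (tag u) := depth_le u.
have tagE (i : 'I_2) : i != ord0 -> i = ord_max.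
  by move=> i0; apply: val_inj; case: i i0 => -[|[|]].
have cardH : #|clique_paths l| = (l ord0).+1 + (l ord_max).+1.
  rewrite card_clique_paths sumnE big_map big_enum /= big_ord_recl big_ord1.
  by congr (_ + (l _).+1); apply: val_inj.
apply: (@path_like_iso G (clique_paths l) (distance w) g) => //.
- move=> u v; rewrite /g; case: eqP => tu; case: eqP => tv => e; apply: clique_paths_inj.
  + by rewrite tu tv.
  + by have := dl u; have := dl v; rewrite tu tv; lia.
  + by lia.
  + by lia.
  + by lia.
  + by lia.
  + by move/eqP/tagE: tu => ->; move/eqP/tagE: tv => ->.
  + by lia.
- by move=> x; apply: distance_lt_card.
- move=> u; rewrite cardH /g; case: eqP => tu; first by lia.
  by have := dl u; move/eqP/tagE: tu => ->; lia.
- move=> x y; wlog le : x y / distance w x <= distance w y => [hw|].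
    have /orP[h|h] := leq_total (distance w x) (distance w y); first exact: hw.
    by rewrite edge_sym orbC; apply: hw.
  apply/idP/idP => [e|h].
    have [d|d|d] := layer_edge cG w e; try by rewrite d eqxx ?orbT.
    by have := edge_neq e; rewrite (inj _ _ d) eqxx.
  have dy : distance w y = (distance w x).+1 by lia.
  by have [z e dz] := distance_pred cG dy; rewrite -(inj _ _ dz).
move=> u v; rewrite edge_clique_paths /g.
have := dl u; have := dl v.
case: (eqVneq (tag u) ord0) => tu; case: (eqVneq (tag v) ord0) => tv.
- by rewrite tu tv eqxx; lia.
- by rewrite tu eq_sym (negPf tv); lia.
- by rewrite tv (negPf tu); lia.
- by rewrite (tagE _ tu) (tagE _ tv) eqxx; lia.
Qed.

(** * The induction *)

Lemma balanced_seq_exists n m : 0 < m <= n -> exists t,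
  [/\ size t = m, sumn t = n, almost_equal t & all (leq 1) t].
Proof.
move=> /andP[m0 mn]; have r := ltn_pmod n m0.
exists (nseq (n %% m) (n %/ m).+1 ++ nseq (m - n %% m) (n %/ m)); split.
- by rewrite size_cat !size_nseq subnKC // ltnW.
- by rewrite sumn_cat !sumn_nseq mulSn -addnA -mulnDr subnKC 1?ltnW // addnC -divn_eq.
- move=> x y; rewrite !mem_cat !mem_nseq => /orP[]/andP[_ /eqP ->] /orP[]/andP[_ /eqP ->]; lia.
- by rewrite all_cat !all_nseq /= divn_gt0 // mn !orbT.
Qed.

Lemma lengths_of_seq m (t : seq nat) : size t = m -> all (leq 1) t ->
  exists l : 'I_m -> nat, [seq (l i).+1 | i <- enum 'I_m] = t.
Proof.
move=> sz t1; exists (fun i => (nth 1 t i).-1).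
apply: (@eq_from_nth _ 1); first by rewrite size_map size_enum_ord.
move=> i; rewrite size_map size_enum_ord => im.
rewrite (nth_map (Ordinal im)) ?size_enum_ord // nth_enum_ord // prednK //.
by apply: (allP t1); apply: mem_nth; rewrite sz.
Qed.

(** Induction on the order and, for fixed order, on the number of missing edges; a saturated graph
    with m > 2 is reduced by removing its pendant path. *)
Lemma paths_RDD_max (n m : nat) (G : sgraph) (t : seq nat) :
    connected G -> #|G| = n -> #|[set v : G | ~~ cut_vertex v]| = m -> 1 < m ->
    size t = m -> sumn t = n -> almost_equal t -> all (leq 1) t ->
  (RDD G <= paths_RDD m t)%R /\
  (RDD G = paths_RDD m t -> exists l : 'I_m -> nat, isomorphic G (clique_paths l) /\
     perm_eq [seq (l i).+1 | i <- enum 'I_m] t).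
Proof.
elim/ltn_ind: n m G t => n IHn m G t cG cardG.
have [k] := ubnP (n ^ 2 - #|[set p : G * G | edge p.1 p.2]|).
elim: k G cG cardG => [//|k IHk] G cG cardG ltk nc m1 sz sm aet t1.
have [satG|/nsaturatedP[x [y [xy nxy keep]]]] := boolP (saturated G); last first.
  have cG' := @connected_add_edge G x y xy cG.
  have cardG' : #|add_edge xy| = n := cardG.
  have lt := @RDD_add_edge G x y xy cG nxy.
  have [] := IHk (add_edge xy) cG' cardG _ _ m1 sz sm aet t1.
  - have := @num_edges_add_edge G x y xy nxy.
    have : #|[set p : add_edge xy * add_edge xy | edge p.1 p.2]| <= n ^ 2.
      by apply: leq_trans (max_card _) _; rewrite card_prod cardG' mulnn.
    by move: ltk; lia.
  - by rewrite (card_noncut_add_edge xy cG keep).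
  move=> le _; have lt' := lt_le_trans lt le; split; first exact: ltW.
  by move=> e; rewrite e ltxx in lt'.
have [w] : exists w : G, w \in [set v : G | ~~ cut_vertex v].
  by apply/card_gt0P; rewrite nc ltnW.
move=> ncw'; have ncw : ~~ cut_vertex w by rewrite inE in ncw'.
have endsE : #|ends w|.+1 = m.
  rewrite -nc (cardsD1 w [set v | _]) ncw' add1n; congr S.
  by apply: eq_card => v; rewrite !inE andbC.
have iso_case (l : 'I_m -> nat) : isomorphic G (clique_paths l) ->
    [/\ RDD G = paths_RDD m [seq (l i).+1 | i <- enum 'I_m],
     all (leq 1) [seq (l i).+1 | i <- enum 'I_m],
     size [seq (l i).+1 | i <- enum 'I_m] = m &
     sumn [seq (l i).+1 | i <- enum 'I_m] = n].
  move=> iso; split.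
  - by rewrite (isomorphic_RDD cG iso) RDD_clique_paths.
  - by apply/allP => x /mapP[i _ ->].
  - by rewrite size_map size_enum_ord.
  by rewrite -card_clique_paths -cardG; have [f /bij_eq_card -> _] := iso.
have [m2|m2] := eqVneq m 2.
  have [l lE] := lengths_of_seq sz t1.
  have e1 : #|ends w| = 1 by lia.
  have iso : isomorphic G (clique_paths l).
    by apply: two_ends_iso e1 m2 _ => //; rewrite card_clique_paths lE sm.
  have [-> _ _ _] := iso_case l iso; rewrite lE; split=> // _.
  by exists l; rewrite lE.
have ends2 : 1 < #|ends w| by lia.
have [a [stem branching]] := stem_length_exists cG satG ends2.
have cG0 := connected_rest cG satG ncw stem branching.
have nc0 := card_noncut_rest cG satG ncw stem branching.
have cardB : a.+1 + #|rest w a| = n.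
  rewrite -cardG -(cardC (mem (rest w a))) addnC; congr (_ + _).
  (* Applied to the constant 1, this counts the a + 1 vertices of the stem. *)
  have := stem_sum stem (fun=> 1%R : rat); rewrite !sumr_const card_ord => /eqP.
  by rewrite eqr_nat => /eqP <-; apply: eq_card => x; rewrite !inE.
have ends_rest : #|ends w| <= #|rest w a|.
  apply: subset_leq_card; apply/subsetP => x xe; rewrite inE.
  exact: (stem_end_false cG satG stem branching xe).
(* [r] is balanced for the rest; [a.+1 :: r] need not be, and is levelled to [t] by
   [paths_RDD_balanced]. *)
have [|r [szr smr aer r1]] := @balanced_seq_exists #|rest w a| #|ends w|.
  by rewrite ends_rest andbT ltnW.
have [] := IHn #|rest w a| _ #|ends w| (induced (rest w a)) r cG0 _ nc0 ends2 szr smr aer r1.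
- by rewrite -cardB; lia.
- by rewrite /= card_sig; apply: eq_card => x; rewrite inE.
move=> le0 _; have [le1 lt1] := RDD_compare cG satG ncw stem branching szr r1 aer smr.
have m2' : 2 < m by rewrite ltn_neqAle eq_sym m2.
have [] := @paths_RDD_balanced m (a.+1 :: r) t m1 _ aet.
- by rewrite /= r1.
- by rewrite /= szr endsE sz.
- by rewrite /= smr cardB sm.
move=> le2 _; rewrite -endsE in le2 *.
(* A branching layer smaller than the number of ends makes the comparison strict, which excludes
   equality; otherwise [full_clique_iso] determines the graph up to its path lengths. *)
have [lt|] := ltnP #|layer w a.+1| #|ends w|.
  have lt2 : (RDD G < paths_RDD #|ends w|.+1 t)%R.
    by move: (lt1 lt) le0 le2; lra.
  by split; [exact: ltW | move=> e; rewrite e ltxx in lt2].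
move=> ge; have full : #|layer w a.+1| = #|ends w|.
  by apply/eqP; rewrite eqn_leq ge (card_layer cG w satG).
rewrite endsE; have [l iso] := full_clique_iso cG satG ncw stem branching full.
rewrite endsE in l iso; have [RDDE l1 szl sml] := iso_case l iso.
have [] := @paths_RDD_balanced m [seq (l i).+1 | i <- enum 'I_m] t m1 l1 aet.
- by rewrite szl sz.
- by rewrite sml sm.
move=> le3 eq3; rewrite RDDE; split=> // e; exists l; split=> //.
exact: eq3.
Qed.

Theorem theorem3p6 (n k : nat) (G : sgraph) (le_k_n2 : k + 2 <= n)
    (order_G : #|G| = n) (conn_G : connected G)
    (cut_G : #|[set v : G | cut_vertex v]| = k) :
  (RDD G <= RDD (Gnk n k))%R /\
  (RDD G = RDD (Gnk n k) <-> isomorphic G (Gnk n k)).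
Proof.
have m1 : 1 < n - k by lia.
have nc : #|[set v : G | ~~ cut_vertex v]| = n - k.
  rewrite [LHS]cardsCs order_G -cut_G; congr (_ - _).
  by apply: eq_card => v; rewrite !inE negbK.
have gE : RDD (Gnk n k) = _ := RDD_clique_paths _ m1.
have [] := @paths_RDD_max n (n - k) G [seq (balanced_length i).+1 | i <- enum 'I_(n - k)]
  conn_G order_G nc m1.
- by rewrite size_map size_enum_ord.
- by rewrite -card_clique_paths card_Gnk //; lia.
- by move=> x y /mapP[i _ ->] /mapP[j _ ->]; rewrite ltnS balanced_length_almost_equal.
- by apply/allP => x /mapP[i _ ->].
rewrite -gE => le eq; split=> //; split; last exact: isomorphic_RDD.
by move=> /eq[l [iso /clique_paths_perm]]; apply: isomorphic_trans.
Qed.
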